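(* Let $\mathcal T_h$ be a conforming triangulation of a polygonal domain $\Omega\subset\mathbb R^2$. For $k=0,1$, the space $U_{k+2,h}$ is a subspace of $C^1(\Omega)$. Here $U_{3,h}$ is the set of $v\in L^2(\Omega)$ such that $v|_T\in U_3(T)$ for all $T\in\mathcal T_h$ and such that the degrees of freedom $v(\mathtt v)$, $\nabla v(\mathtt v)$ (at vertices $\mathtt v$) and $\int_e\partial_nv\,q\,{\rm d}s$, $q\in\mathbb P_0(e)$ (on edges $e$) are single-valued; and $U_{2,h}$ is the set of $v\in L^2(\Omega)$ such that $v|_T\in U_2(T)$ for all $T\in\mathcal T_h$ and such that the vertex degrees of freedom $v(\mathtt v)$, $\nabla v(\mathtt v)$ are single-valued.
   Context: A degree of freedom is single-valued if it takes the same value when computed from every triangle of $\mathcal T_h$ containing the given vertex or edge; for this a unit normal $\boldsymbol n_e$ is fixed for each edge $e$ and $\partial_nv=\nabla v\cdot\boldsymbol n_e$ on $e$. Local spaces. Let $T$ be a triangle with vertices $\mathtt v_0,\mathtt v_1,\mathtt v_2$, area $|T|$ and barycenter $\mathtt v_c=(\mathtt v_0+\mathtt v_1+\mathtt v_2)/3$. The barycentric refinement splits $T$ into subtriangles $T_0,T_1,T_2$, where $T_i$ is the convex hull of $\mathtt v_c$ and the two vertices $\mathtt v_j$, $j\ne i$. $\lambda_i$ is the barycentric coordinate of $T$ associated with $\mathtt v_i$; $\lambda_i^{\rm R}$ is the continuous function on $T$, affine on each $T_j$, with $\lambda_i^{\rm R}(\mathtt v_i)=1$ and value $0$ at $\mathtt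 v_c$ and at the other two vertices. Indices $i\in\{0,1,2\}$ are understood modulo 3. $e_i$ is the edge opposite to $\mathtt v_i$ with unit normal $\boldsymbol n_i$, $c_{i,i}=\nabla\lambda_i\cdot\boldsymbol n_i$, and $C_T=4|T|^2/9$. Put $$v_{i,i+1}=\tfrac{C_T}{2}\bigl[(\lambda_i^{\rm R})^2-\lambda_i^2\bigr](\lambda_{i-1}-\lambda_{i+1})-C_T\lambda_0\lambda_1\lambda_2,\qquad v_{i,i-1}=\tfrac{C_T}{2}\bigl[(\lambda_i^{\rm R})^2-\lambda_i^2\bigr](\lambda_{i-1}-\lambda_{i+1})+C_T\lambda_0\lambda_1\lambda_2,$$ $$w_i=\frac{1}{4C_Tc_{i,i}}\bigl(v_{i+1,i}-v_{i-1,i}\bigr),\qquad i=0,1,2.$$ Then $U_3(T)=\mathbb P_3(T)+\operatorname{span}\{w_0,w_1,w_2\}$ and $U_2(T)=\{v\in U_3(T):\partial_nv|_e\in\mathbb P_1(e)\text{ for every edge }e\text{ of }T\}$. $\mathbb P_m$ denotes polynomials of degree at most $m$. *)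

(* Defs.v *)
From HB Require Import structures.
From mathcomp Require Import all_boot all_order all_algebra.
From mathcomp Require Import all_classical all_reals all_analysis.

Set Implicit Arguments.
Unset Strict Implicit.
Unset Printing Implicit Defensive.
Import Order.TTheory GRing.Theory Num.Theory.
Import numFieldNormedType.Exports.
Local Open Scope classical_set_scope.
Local Open Scope ring_scope.

(* Points of the plane are pairs [R * R]; the norm of the product is the sup
   norm, so Euclidean quantities are written with [dot].
   A triangle is given by its vertices [p : 'I_3 -> R * R]; ['I_3] carries the
   arithmetic of Z/3, so that [i + 1] and [i - 1] are taken modulo 3. *)

Section Plane.
Context {R : realType}.
Local Notation pt := (R * R)%type.
Implicit Types (a b x n : pt) (p : 'I_3 -> pt) (f : pt -> R) (A : set pt).

Definition leb2 := (@lebesgue_measure R \x @lebesgue_measure R)%E.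

Definition dot a b : R := a.1 * b.1 + a.2 * b.2.

Definition det2 a b : R := a.1 * b.2 - a.2 * b.1.

Definition hull N (q : 'I_N -> pt) : set pt :=
  [set x | exists t : 'I_N -> R,
     [/\ forall i, 0 <= t i, \sum_i t i = 1 & x = \sum_i t i *: q i]].

Definition seg_path a b (t : R) : pt := (1 - t) *: a + t *: b.

Definition segm a b : set pt := seg_path a b @` `[0, 1].

Definition grad f x : pt := ('D_((1, 0) : pt) f x, 'D_((0, 1) : pt) f x).

(* The gradient at [x] of the restriction of [f] to [A]; the points of
   interest are the vertices and edge points of a triangle [A]. *)
Definition has_grad_on A f x (g : pt) : Prop :=
  ((f y - f x - dot g (y - x)) / `|y - x|) @[y --> within A (nbhs x)] --> (0 : R).

Definition grad_on A f x : pt := get (has_grad_on A f x).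

Definition affine_on A f : Prop :=
  exists (g : pt) (c : R), forall x, A x -> f x = dot g x + c.

Definition poly2 (m : nat) f : Prop :=
  exists c : nat -> nat -> R, forall x,
    f x = \sum_(i < m.+1) \sum_(j < m.+1 | (i + j <= m)%N)
            c i j * x.1 ^+ i * x.2 ^+ j.

Definition poly_on_segm (m : nat) a b f : Prop :=
  exists2 q : {poly R}, (size q <= m.+1)%N &
    forall t, t \in `[0, 1] -> f (seg_path a b t) = q.[t].

Definition segm_integral a b f : R :=
  Num.sqrt (dot (b - a) (b - a)) *
  \int[@lebesgue_measure R]_(t in `[0, 1]) f (seg_path a b t).

Definition unit_normal a b n : Prop := dot n n = 1 /\ dot n (b - a) = 0.

Definition edge p (i : 'I_3) : set pt := segm (p (i + 1)) (p (i - 1)).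

Definition barycenter p : pt := (3%:R)^-1 *: \sum_i p i.

Definition subtri p (j : 'I_3) : set pt :=
  hull (fun l : 'I_3 => if l == j then barycenter p else p l).

Definition det_tri p : R := det2 (p 1 - p 0) (p 2%:R - p 0).

Definition area p : R := `|det_tri p| / 2.

(* Barycentric coordinates, as quotients of signed areas. *)
Definition bary p (i : 'I_3) x : R :=
  det2 (p (i + 1) - x) (p (i - 1) - x) /
  det2 (p (i + 1) - p i) (p (i - 1) - p i).

Definition refined_bary p (lR : 'I_3 -> pt -> R) : Prop :=
  forall i : 'I_3,
    [/\ {within hull p, continuous (lR i)},
        forall j, affine_on (subtri p j) (lR i),
        forall j, lR i (p j) = (j == i)%:R &
        lR i (barycenter p) = 0].

Section Local.
Variables (p : 'I_3 -> pt) (nrm : 'I_3 -> pt) (lR : 'I_3 -> pt -> R).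
Local Notation lam := (bary p).

Definition C_T : R := 4 * area p ^+ 2 / 9.

(* [lam i] is affine, so its gradient can be taken at any point. *)
Definition c_diag (i : 'I_3) : R := dot (grad (lam i) (p i)) (nrm i).

Definition bubble x : R := lam 0 x * lam 1 x * lam 2%:R x.

(* [v_next i] and [v_prev i] are v_{i,i+1} and v_{i,i-1}. *)
Definition v_next (i : 'I_3) x : R :=
  C_T / 2 * (lR i x ^+ 2 - lam i x ^+ 2) * (lam (i - 1) x - lam (i + 1) x)
  - C_T * bubble x.

Definition v_prev (i : 'I_3) x : R :=
  C_T / 2 * (lR i x ^+ 2 - lam i x ^+ 2) * (lam (i - 1) x - lam (i + 1) x)
  + C_T * bubble x.

Definition w (i : 'I_3) x : R :=
  (4 * C_T * c_diag i)^-1 * (v_prev (i + 1) x - v_next (i - 1) x).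

End Local.

(* The functions on the plane whose restriction to the triangle is in U_3(T),
   resp. U_2(T); [nrm i] is the unit normal of the edge [i]. *)
Definition U3 p (nrm : 'I_3 -> pt) : set (pt -> R) :=
  [set f | exists (lR : 'I_3 -> pt -> R) (q : pt -> R) (a : 'I_3 -> R),
     [/\ refined_bary p lR, poly2 3 q &
         forall x, hull p x -> f x = q x + \sum_i a i * w p nrm lR i x]].

Definition dnormal p n f x : R := dot (grad_on (hull p) f x) n.

Definition U2 p (nrm : 'I_3 -> pt) : set (pt -> R) :=
  [set f | U3 p nrm f /\
     forall i, poly_on_segm 1 (p (i + 1)) (p (i - 1)) (dnormal p (nrm i) f)].

Definition polygonal_domain (Omega : set pt) : Prop :=
  [/\ open Omega, connected Omega, Omega !=set0, bounded_set Omega &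
      exists s : seq (pt * pt),
        closure Omega `\` Omega = \bigcup_(ab in [set` s]) segm ab.1 ab.2].

Definition conforming_triangulation (Omega : set pt) N
    (Th : 'I_N -> 'I_3 -> pt) : Prop :=
  [/\ forall i, det_tri (Th i) != 0,
      closure Omega = \bigcup_(i in [set: 'I_N]) hull (Th i) &
      forall i j, i != j ->
        let I := hull (Th i) `&` hull (Th j) in
        [\/ I = set0,
            exists k l, Th i k = Th j l /\ I = [set Th i k] |
            exists k l, edge (Th i) k = edge (Th j) l /\ I = edge (Th i) k]].

(* A unit normal for each edge of the mesh. It is a function of the edge as a
   set, so that two triangles sharing an edge use the same normal there. *)
Definition edge_normals N (Th : 'I_N -> 'I_3 -> pt) (ne : set pt -> pt) : Prop :=
  forall i k, unit_normal (Th i (k + 1)) (Th i (k - 1)) (ne (edge (Th i) k)).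

Section Global.
Variables (Omega : set pt) (N : nat) (Th : 'I_N -> 'I_3 -> pt).
Variable ne : set pt -> pt.

Definition L2 : set (pt -> R) :=
  [set v | patch (fun=> 0) Omega v \in Lfun leb2 2%:E].

Definition nrm_of (i : 'I_N) (k : 'I_3) : pt := ne (edge (Th i) k).

(* [F i] stands for the restriction of the function to the triangle [Th i]. *)
Definition vertex_single_valued (F : 'I_N -> pt -> R) : Prop :=
  forall i j k l, Th i k = Th j l ->
    F i (Th i k) = F j (Th j l) /\
    grad_on (hull (Th i)) (F i) (Th i k) = grad_on (hull (Th j)) (F j) (Th j l).

Definition edge_single_valued (F : 'I_N -> pt -> R) : Prop :=
  forall i j k l, edge (Th i) k = edge (Th j) l ->
  forall q : pt -> R, poly_on_segm 0 (Th i (k + 1)) (Th i (k - 1)) q ->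
    segm_integral (Th i (k + 1)) (Th i (k - 1))
      (fun x => dnormal (Th i) (nrm_of i k) (F i) x * q x) =
    segm_integral (Th j (l + 1)) (Th j (l - 1))
      (fun x => dnormal (Th j) (nrm_of j l) (F j) x * q x).

(* Elements of L^2(Omega) are classes modulo a.e. equality on Omega; the spaces
   below are the sets of all representatives of their classes. *)
Definition U3h : set (pt -> R) :=
  [set v | L2 v /\ exists F : 'I_N -> pt -> R,
     [/\ forall i, U3 (Th i) (nrm_of i) (F i),
         forall i, v = F i %[ae leb2 in Omega `&` hull (Th i)],
         vertex_single_valued F & edge_single_valued F]].

Definition U2h : set (pt -> R) :=
  [set v | L2 v /\ exists F : 'I_N -> pt -> R,
     [/\ forall i, U2 (Th i) (nrm_of i) (F i),
         forall i, v = F i %[ae leb2 in Omega `&` hull (Th i)] &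
         vertex_single_valued F]].

Definition C1 : set (pt -> R) :=
  [set u | forall x, Omega x ->
     differentiable u x /\ {for x, continuous (grad u)}].

(* A linear subspace each of whose classes has a representative in
   C^1(Omega). *)
Definition subspace_of_C1 (U : set (pt -> R)) : Prop :=
  [/\ U (fun=> 0),
      forall (a : R) u v, U u -> U v -> U (fun x => a * u x + v x) &
      forall v, U v -> exists2 u, C1 u & v = u %[ae leb2 in Omega]].

End Global.

End Plane.

(* Main.v *)
Require Import Defs.
From HB Require Import structures.
From mathcomp Require Import all_boot all_order all_algebra.
From mathcomp Require Import all_classical all_reals all_analysis.
From mathcomp Require Import ring lra zify.

Set Implicit Arguments.
Unset Strict Implicit.
Unset Printing Implicit Defensive.
Import Order.TTheory GRing.Theory Num.Theory.
Import numFieldNormedType.Exports.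
Local Open Scope classical_set_scope.
Local Open Scope ring_scope.

(** Each triangle is cut into its three subtriangles.  On the subtriangle
    opposite to vertex [k], the barycentric coordinate [lambda_k] is the
    smallest of the three and [lambda_i^R = lambda_i - lambda_k]
    ([refined_bary_subtri]), so a function of [U_3(T)] is there a cubic
    polynomial [P_k].  Between two pieces,
    [P_k - P_l = (lambda_k - lambda_l) Q] with [Q] vanishing on the interface
    [lambda_k = lambda_l]: in each basis function either the factor
    [lambda_k + lambda_l - 2 lambda_i] or the factor
    [lambda_(i-1) - lambda_(i+1)] vanishes there.  Hence the gradients of the
    pieces agree on the interfaces and the functions of [U_3(T)] are C^1 up to
    the boundary of [T] ([U3_pieces], [U3_spline]).

    An edge of [T] lies in a single subtriangle.  Along it the function is a
    cubic in one variable and its normal derivative a quadratic.  The values and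
    gradients at the two ends determine the cubic (Hermite interpolation), hence
    the trace and the tangential derivative.  The normal derivative is known at
    the ends as well; in [U_2(T)] it is affine, hence determined, and for
    [U_3(T)] its integral over the edge gives the midpoint value through
    Simpson's rule, which is exact on quadratics
    ([quadratic_on_segm_unique]).  So two neighbouring triangles induce the same
    values and gradients on the common edge ([U3_edge_match]).

    Finally finitely many closed pieces cover the domain, and the functions and
    their continuous gradients agree wherever pieces meet.  A first order
    expansion at a point holds if it holds along each of the finitely many
    closed pieces through the point ([has_grad_glue]), and continuity of the
    gradient is glued in the same way ([continuous_glue]); no description of the
    triangles around a vertex is needed.  This gives the C^1 representative
    ([C1_representative]).

    The spaces are linear because on [U_3(T)] the gradient relative to [T] and,
    by Simpson's rule, the edge integrals are linear.  That they contain [0]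
    rests on the existence of the functions [lambda_i^R], obtained as
    [lambda_i - min (lambda_0, lambda_1, lambda_2)]. *)

(** * Gradients relative to a set *)

Section Gradients.
Context {R : realType}.
Local Notation pt := (R * R)%type.
Implicit Types (a b x y z g n : pt) (f h : pt -> R) (A B : set pt).

Lemma dotDl a b x : dot (a + b) x = dot a x + dot b x.
Proof. by rewrite /dot /=; ring. Qed.

Lemma dotDr a b x : dot x (a + b) = dot x a + dot x b.
Proof. by rewrite /dot /=; ring. Qed.

Lemma dotBl a b x : dot (a - b) x = dot a x - dot b x.
Proof. by rewrite /dot /=; ring. Qed.

Lemma dotBr a b x : dot x (a - b) = dot x a - dot x b.
Proof. by rewrite /dot /=; ring. Qed.

Lemma dotZl (c : R) a x : dot (c *: a) x = c * dot a x.
Proof. by rewrite /dot /= /GRing.scale /=; ring. Qed.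

Lemma dotZr (c : R) a x : dot x (c *: a) = c * dot x a.
Proof. by rewrite /dot /= /GRing.scale /=; ring. Qed.

Lemma dot0l x : dot 0 x = 0.
Proof. by rewrite -[0](subrr x) dotBl subrr. Qed.

Lemma dot0r x : dot x 0 = 0.
Proof. by rewrite -[X in dot _ X](subrr x) dotBr subrr. Qed.

Lemma dot_gt0 z : z != 0 -> 0 < dot z z.
Proof.
case: z => x y; apply: contra_neqT; rewrite /dot /= -!expr2 -leNgt => le0.
have [x0 y0] : x = 0 /\ y = 0.
  have := sqr_ge0 x; have := sqr_ge0 y => y0 x0.
  by split; apply/eqP; rewrite -sqrf_eq0; apply/eqP; lra.
by rewrite x0 y0.
Qed.

Lemma dot_le g x : `|dot g x| <= (`|g.1| + `|g.2|) * `|x|.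
Proof.
rewrite mulrDl; apply: (le_trans (ler_normD _ _)); rewrite !normrM.
by apply: lerD; rewrite ler_wpM2l // [leRHS]prod_normE le_max lexx ?orbT.
Qed.

(** Cramer: two independent directional derivatives determine a gradient. *)
Lemma dot_sep x y g g' : det2 x y != 0 ->
  dot g x = dot g' x -> dot g y = dot g' y -> g = g'.
Proof.
case: x y g g' => [x1 x2] [y1 y2] [a b] [c d]; rewrite /det2 /dot /= => D e1 e2.
have E1 : (x1 * y2 - x2 * y1) * (a - c) = 0.
  transitivity (y2 * (a * x1 + b * x2 - (c * x1 + d * x2))
              - x2 * (a * y1 + b * y2 - (c * y1 + d * y2))); first by ring.
  by rewrite e1 e2 !subrr !mulr0 subr0.
have E2 : (x1 * y2 - x2 * y1) * (b - d) = 0.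
  transitivity (x1 * (a * y1 + b * y2 - (c * y1 + d * y2))
              - y1 * (a * x1 + b * x2 - (c * x1 + d * x2))); first by ring.
  by rewrite e1 e2 !subrr !mulr0 subr0.
move/eqP: E1; move/eqP: E2; rewrite !mulf_eq0 (negbTE D) /= !subr_eq0.
by move=> /eqP -> /eqP ->.
Qed.

(** The expansion error is [o(|y - x|)].  In this form the base point needs no
    separate treatment, and estimates on several sets can be combined. *)
Lemma has_gradP A f x g : has_grad_on A f x g <->
  forall e, 0 < e ->
    \forall y \near x, A y -> `|f y - f x - dot g (y - x)| <= e * `|y - x|.
Proof.
split.
  move=> /cvgrPdist_le H e e0; have := H e e0; rewrite near_withinE.
  apply: filterS => y Hy /Hy; rewrite sub0r normrN normrM normfV normr_id.
  have [->|yx] := eqVneq y x.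
    by move=> _; rewrite !subrr dot0r subrr !normr0 mulr0.
  by rewrite ler_pdivrMr // normr_gt0 subr_eq0.
move=> H; apply/cvgrPdist_le => e e0; rewrite near_withinE.
apply: filterS (H e e0) => y Hy /Hy.
rewrite sub0r normrN normrM normfV normr_id.
have [->|yx] := eqVneq y x.
  by move=> _; rewrite !subrr dot0r subrr normr0 mul0r ltW.
by rewrite ler_pdivrMr // normr_gt0 subr_eq0.
Qed.

Lemma sub_has_grad A B f x g : A `<=` B ->
  has_grad_on B f x g -> has_grad_on A f x g.
Proof.
move=> AB /has_gradP H; apply/has_gradP => e e0; near=> y => Ay.
by move: (AB _ Ay); near: y; exact: H.
Unshelve. all: by end_near.
Qed.

Lemma eq_has_grad A f h x g : A x -> {in A, f =1 h} ->
  has_grad_on A f x g -> has_grad_on A h x g.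
Proof.
move=> Ax fh /has_gradP H; apply/has_gradP => e e0; near=> y => Ay.
rewrite -!fh ?inE //.
by move: Ay; near: y; exact: H.
Unshelve. all: by end_near.
Qed.

Lemma has_grad_cst A (c : R) x : has_grad_on A (cst c) x 0.
Proof.
apply/has_gradP => e e0; near=> y => _.
by rewrite subrr dot0l subr0 normr0 mulr_ge0 // ltW.
Unshelve. all: by end_near.
Qed.

Lemma has_grad_dot A g x : has_grad_on A (dot g) x g.
Proof.
apply/has_gradP => e e0; near=> y => _.
by rewrite -dotBr subrr normr0 mulr_ge0 // ltW.
Unshelve. all: by end_near.
Qed.

Lemma has_gradD A f h x g g' : has_grad_on A f x g -> has_grad_on A h x g' ->
  has_grad_on A (fun y => f y + h y) x (g + g').
Proof.
move=> /has_gradP F /has_gradP H; apply/has_gradP => e e0.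
have e2 : 0 < e / 2 by rewrite divr_gt0.
apply: filterS2 (F _ e2) (H _ e2) => y + + Ay => /(_ Ay) Fy /(_ Ay) Hy.
rewrite dotDl (_ : _ - _ = (f y - f x - dot g (y - x)) +
  (h y - h x - dot g' (y - x))); last by ring.
apply: (le_trans (ler_normD _ _)).
by rewrite [e]splitr mulrDl lerD.
Qed.

(** The error of the product is [f x] times the error of [h], plus [h x] times
    the error of [f], plus [(f y - f x) (h y - h x)]; the last term is quadratic
    in [|y - x|] since both factors are Lipschitz at [x]. *)
Lemma has_gradM A f h x g g' : has_grad_on A f x g -> has_grad_on A h x g' ->
  has_grad_on A (fun y => f y * h y) x (f x *: g' + h x *: g).
Proof.
move=> /has_gradP F /has_gradP H; apply/has_gradP => e e0.
pose K := `|f x| + `|h x| + 1.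
have K0 : 0 < K by rewrite ltr_wpDl // addr_ge0.
pose L := `|g.1| + `|g.2| + 1.
pose L' := `|g'.1| + `|g'.2| + 1.
have L0 : 0 < L by rewrite ltr_wpDl // addr_ge0.
have L'0 : 0 < L' by rewrite ltr_wpDl // addr_ge0.
have e1 : 0 < e / 2 / K by rewrite !divr_gt0.
have e2 : 0 < e / 2 / (L * L') by rewrite !divr_gt0 // mulr_gt0.
have nb : \forall y \near x, `|y - x| <= e / 2 / (L * L').
  near=> y; rewrite distrC; near: y.
  by apply: (@cvgr_dist_le _ _ _ (nbhs x)) => //; exact: cvg_id.
(* An expansion at x with error at most |y - x| makes f' Lipschitz at x. *)
have lip f' k : (forall e, 0 < e -> \forall y \near x, A y ->
    `|f' y - f' x - dot k (y - x)| <= e * `|y - x|) ->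
    \forall y \near x, A y ->
      `|f' y - f' x| <= (`|k.1| + `|k.2| + 1) * `|y - x|.
  move=> /(_ 1 ltr01); apply: filterS => y Hy /Hy {}Hy.
  rewrite -[f' y - f' x](subrK (dot k (y - x))) addrC.
  by apply: (le_trans (ler_normD _ _)); rewrite [leRHS]mulrDl lerD // dot_le.
have lf := lip _ _ F; have lh := lip _ _ H.
near=> y => Ay.
have -> : f y * h y - f x * h x - dot (f x *: g' + h x *: g) (y - x) =
   (f x * (h y - h x - dot g' (y - x)) + h x * (f y - f x - dot g (y - x))) +
   (f y - f x) * (h y - h x).
  by rewrite dotDl !dotZl; ring.
apply: (le_trans (ler_normD _ _)); rewrite [e]splitr [leRHS]mulrDl lerD //.
  apply: (le_trans (ler_normD _ _)); rewrite !normrM.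
  have Hf : `|f y - f x - dot g (y - x)| <= e / 2 / K * `|y - x|.
    by move: Ay; near: y; exact: F.
  have Hh : `|h y - h x - dot g' (y - x)| <= e / 2 / K * `|y - x|.
    by move: Ay; near: y; exact: H.
  apply: (@le_trans _ _ ((`|f x| + `|h x|) * (e / 2 / K * `|y - x|))).
    by rewrite mulrDl lerD // ler_wpM2l.
  have -> : e / 2 * `|y - x| = K * (e / 2 / K * `|y - x|).
    by rewrite mulrA [K * _]mulrC divfK // gt_eqF.
  rewrite ler_wpM2r ?lerDl //; last by rewrite mulr_ge0 // ltW.
rewrite normrM.
have Hf : `|f y - f x| <= L * `|y - x| by move: Ay; near: y; exact: lf.
have Hh : `|h y - h x| <= L' * `|y - x| by move: Ay; near: y; exact: lh.
have Hn : `|y - x| <= e / 2 / (L * L') by near: y.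
apply: (le_trans (ler_pM _ _ Hf Hh)) => //.
rewrite mulrACA mulrA ler_wpM2r // mulrC -ler_pdivlMr // mulr_gt0 //.
Unshelve. all: by end_near.
Qed.

Lemma has_grad_linear A (c : R) f h x g g' :
  has_grad_on A f x g -> has_grad_on A h x g' ->
  has_grad_on A (fun y => c * f y + h y) x (c *: g + g').
Proof.
move=> G G'; apply: has_gradD G'.
by have := has_gradM (has_grad_cst A c x) G; rewrite scaler0 addr0.
Qed.

(** At a corner of [A] only the directions of segments issued from [x] inside [A]
    are available, and each of them determines one component of the gradient. *)
Lemma has_grad_dir A f x g g' z :
  (forall t : R, 0 <= t <= 1 -> A (x + t *: (z - x))) ->
  has_grad_on A f x g -> has_grad_on A f x g' ->
  dot g (z - x) = dot g' (z - x).
Proof.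
move=> sA /has_gradP G /has_gradP G'.
have [->|zx] := eqVneq z x; first by rewrite subrr !dot0r.
have nz : 0 < `|z - x| by rewrite normr_gt0 subr_eq0.
apply/eqP; rewrite -subr_eq0 -normr_eq0 -dotBl eq_le normr_ge0 andbT.
apply/ler_addgt0Pl => e e0; rewrite addr0.
have e2 : 0 < e / 2 / `|z - x| by rewrite !divr_gt0.
have tx : (x + t *: (z - x)) @[t --> 0^'+] --> x.
  rewrite -[in X in _ --> X](addr0 x) -[X in x + X](scale0r (z - x)).
  apply: cvgD; first exact: cvg_cst.
  by apply: cvgZr_tmp; apply: cvg_at_right_filter; exact: cvg_id.
have nt k : (\forall y \near x, A y ->
      `|f y - f x - dot k (y - x)| <= e / 2 / `|z - x| * `|y - x|) ->
    \forall t \near (0 : R)^'+, A (x + t *: (z - x)) ->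
      `|f (x + t *: (z - x)) - f x - dot k (x + t *: (z - x) - x)| <=
      e / 2 / `|z - x| * `|x + t *: (z - x) - x| by exact: tx.
have n1 := nt _ (G _ e2); have n2 := nt _ (G' _ e2).
have [t [[t0 t1] [H1 H2]]] := filter_ex (filterI
  (filterI (nbhs_right_gt (0 : R)) (nbhs_right_le ltr01)) (filterI n1 n2)).
have At : A (x + t *: (z - x)) by apply: sA; rewrite ltW.
move: (H2 At) (H1 At).
rewrite [x + _]addrC addrK; set F := f _ - f x => {}H2 {}H1.
have : t * `|dot (g - g') (z - x)| <= t * e.
  rewrite -[t in leLHS]gtr0_norm // -normrM -dotZr dotBl.
  rewrite (_ : _ - _ = (F - dot g' (t *: (z - x))) - (F - dot g (t *: (z - x)))).
    apply: (le_trans (ler_normB _ _)).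
        apply: (le_trans (lerD H2 H1)).
    rewrite normrZ gtr0_norm // -mulrDl -mulrDl -splitr.
    rewrite [leLHS](_ : _ = t * e * (`|z - x|^-1 * `|z - x|)); last by ring.
    by rewrite mulVf ?mulr1 // gt_eqF.
  by ring.
by rewrite ler_pM2l.
Qed.

Lemma has_grad_unique f x g g' :
  has_grad_on setT f x g -> has_grad_on setT f x g' -> g = g'.
Proof.
move=> G G'; apply: (@dot_sep (x + (1, 0) - x) (x + (0, 1) - x)).
- by rewrite ![x + _ - x]addrC !addKr /det2 /= mulr1 mulr0 subr0 oner_eq0.
- exact: (has_grad_dir _ G G').
- exact: (has_grad_dir _ G G').
Qed.

(** Near [x] only the closed pieces that contain [x] matter, and there are
    finitely many of them, so their estimates hold simultaneously. *)
Lemma has_grad_glue (I : finType) (A : I -> set pt) B f x g :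
  B `<=` \bigcup_i A i -> (forall i, closed (A i)) ->
  (forall i, A i x -> has_grad_on (A i) f x g) ->
  has_grad_on B f x g.
Proof.
move=> cov clA G; apply/has_gradP => e e0.
have near_piece i : \forall y \near x, A i y ->
    `|f y - f x - dot g (y - x)| <= e * `|y - x|.
  have [Ax|nAx] := pselect (A i x).
    by have /has_gradP := G i Ax; exact.
  have nA : nbhs x (~` A i).
    by apply: open_nbhs_nbhs; split => //; exact: closed_openC.
  near=> y => Ay; suff : (~` A i) y by [].
  by near: y.
have near_pieces : \forall y \near x, forall i, A i y ->
    `|f y - f x - dot g (y - x)| <= e * `|y - x|.
  exact: (@filter_forall _ I _ (nbhs x)).
near=> y => /cov [i _ Ay].
have H : forall i, A i y -> `|f y - f x - dot g (y - x)| <= e * `|y - x|.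
  by near: y.
exact: H Ay.
Unshelve. all: by end_near.
Qed.

End Gradients.

(** * Gradients and differentials *)

Section Differentiability.
Context {R : realType}.
Local Notation pt := (R * R)%type.
Implicit Types (a b x y z g n : pt) (f h : pt -> R) (A B : set pt).

Lemma dot_linear g : linear (dot g).
Proof. by move=> c u v; rewrite dotDr dotZr. Qed.

HB.instance Definition _ g := GRing.isLinear.Build R pt R *%R (dot g) (dot_linear g).

Lemma dot_continuous g : continuous (dot g).
Proof.
move=> x; rewrite /dot; apply: (@cvgD _ _ _ (nbhs x)).
  apply: (@cvgM _ _ (nbhs x)); [exact: cvg_cst|exact: cvg_fst].
apply: (@cvgM _ _ (nbhs x)); [exact: cvg_cst|exact: cvg_snd].
Qed.

Lemma has_grad_differentiable f x g : has_grad_on setT f x g ->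
  differentiable f x /\ grad f x = g.
Proof.
move=> /has_gradP G.
have E : f \o shift x = cst (f x) + (dot g : pt -> R) +o_ (0 : pt) id.
  apply/eqaddoP => e e0.
  have sx : h + x @[h --> (0 : pt)] --> x.
    rewrite -[in X in _ --> X](add0r x).
    by apply: (@cvgD _ _ _ (nbhs (0 : pt))); [exact: cvg_id|exact: cvg_cst].
  have nG : \forall h \near (0 : pt), setT (h + x) ->
    `|f (h + x) - f x - dot g (h + x - x)| <= e * `|h + x - x| by exact: sx (G _ e0).
  near=> h.
  rewrite /= !fctE /=.
  have : `|f (h + x) - f x - dot g (h + x - x)| <= e * `|h + x - x|.
    by near: h; apply: filterS nG => h; apply.
  by rewrite addrK (opprD (f x)) addrA.
have D : 'd f x = dot g :> (pt -> R) by apply: diff_unique => //; exact: dot_continuous.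
have df : differentiable f x.
  apply/diff_locallyP; rewrite D; split; [move=> y; exact: dot_continuous|exact: E].
split => //.
by rewrite /grad !deriveE // D /dot /= !(mulr1, mulr0, addr0, add0r) -surjective_pairing.
Unshelve. all: by end_near.
Qed.
End Differentiability.

(** * Polynomial functions and their gradients *)

Section PolynomialFunctions.
Context {R : realType}.
Local Notation pt := (R * R)%type.
Implicit Types (a b x y z v : pt) (f h : pt -> R) (g : pt -> pt).

(** A degree bound on all restrictions to lines, which is the only use made of
    the degree.  The gradient is bundled in because its restrictions must have one
    degree less, the zero polynomial when [m = 0], so that the bounds are stable
    under products. *)
Definition poly_with_grad m f g : Prop :=
  [/\ continuous g,
      forall x, has_grad_on setT f x (g x),
      forall a b, exists2 q : {poly R}, (size q <= m.+1)%N & forall t,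
        f (seg_path a b t) = q.[t] /\
        dot (g (seg_path a b t)) (b - a) = q^`().[t] &
      forall a b v, exists2 r : {poly R}, (size r <= m)%N & forall t,
        dot (g (seg_path a b t)) v = r.[t]].

Definition polyfun m f := exists g, poly_with_grad m f g.

Lemma polyfun_cst m (c : R) : polyfun m (cst c).
Proof.
exists (cst 0); split.
- by move=> x; exact: cvg_cst.
- by move=> x; exact: has_grad_cst.
- move=> a b; exists c%:P => [|t]; first by rewrite (leq_trans (size_polyC_leq1 _)).
  by rewrite hornerC dot0l derivC horner0.
- by move=> a b n; exists 0 => [|t]; rewrite ?size_poly0 // dot0l horner0.
Qed.

Lemma polyfun_dot v : polyfun 1 (dot v).
Proof.
exists (cst v); split.
- by move=> x; exact: cvg_cst.
- by move=> x; exact: has_grad_dot.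
- move=> a b; exists ((dot v (b - a))%:P * 'X + (dot v a)%:P) => [|t].
    by rewrite size_MXaddC; case: ifP => // _; rewrite ltnS size_polyC_leq1.
  split; last by rewrite derivD derivM !derivC derivX mul0r add0r mulr1 addr0 hornerC.
  by rewrite hornerMXaddC hornerC dotBr /seg_path dotDr !dotZr; ring.
- move=> a b n; exists (dot v n)%:P => [|t]; first exact: size_polyC_leq1.
  by rewrite hornerC.
Qed.

Lemma polyfun_leq m n f : (m <= n)%N -> polyfun m f -> polyfun n f.
Proof.
move=> mn [g [? ? H1 H2]]; exists g; split => //.
- by move=> a b; have [q sq ?] := H1 a b; exists q => //; exact: leq_trans sq _.
- by move=> a b v; have [q sq ?] := H2 a b v; exists q => //; exact: leq_trans sq _.
Qed.

Lemma polyfunD m f h : polyfun m f -> polyfun m h -> polyfun m (fun x => f x + h x).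
Proof.
move=> [g [cg gf F1 F2]] [k [ck kh H1 H2]]; exists (fun x => g x + k x); split.
- by move=> x; apply: (@cvgD _ _ _ (nbhs x)); [exact: cg|exact: ck].
- by move=> x; exact: has_gradD.
- move=> a b; have [q sq Q] := F1 a b; have [r sr S] := H1 a b.
  exists (q + r) => [|t].
    by rewrite (leq_trans (size_polyD _ _)) // geq_max sq.
  have [-> dq] := Q t; have [-> dr] := S t.
  by rewrite dotDl dq dr derivD !hornerD.
- move=> a b v; have [q sq Q] := F2 a b v; have [r sr S] := H2 a b v.
  exists (q + r) => [|t].
    by rewrite (leq_trans (size_polyD _ _)) // geq_max sq.
  by rewrite dotDl Q S hornerD.
Qed.

Lemma polyfunM m n f h : polyfun m f -> polyfun n h ->
  polyfun (m + n) (fun x => f x * h x).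
Proof.
move=> [g [cg gf F1 F2]] [k [ck kh H1 H2]].
have dcont (f' : pt -> R) (g' x : pt) :
    has_grad_on setT f' x g' -> {for x, continuous f'}.
  by move=> /has_grad_differentiable [] /differentiable_continuous.
exists (fun x => f x *: k x + h x *: g x); split.
- move=> x; apply: (@cvgD _ _ _ (nbhs x)).
  + by apply: (@cvgZ _ _ _ (nbhs x)); [exact: dcont (gf x)|exact: ck].
  + by apply: (@cvgZ _ _ _ (nbhs x)); [exact: dcont (kh x)|exact: cg].
- by move=> x; exact: has_gradM.
- move=> a b; have [q sq Q] := F1 a b; have [r sr S] := H1 a b.
  exists (q * r) => [|t].
    rewrite (leq_trans (size_polyMleq _ _)) //.
    by move: sq sr; case: (size q) => [|?]; case: (size r) => [|?] /=; lia.
  have [-> dq] := Q t; have [-> dr] := S t.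
  by rewrite dotDl !dotZl dq dr derivM !hornerE; split=> //; ring.
- move=> a b v.
  have [q sq Q] := F1 a b; have [r sr S] := H1 a b.
  have [q' sq' Q'] := F2 a b v; have [r' sr' S'] := H2 a b v.
  exists (q * r' + r * q') => [|t].
    rewrite (leq_trans (size_polyD _ _)) // geq_max.
    apply/andP; split; apply: (leq_trans (size_polyMleq _ _)); lia.
  by rewrite dotDl !dotZl Q' S' (Q t).1 (S t).1 !hornerE.
Qed.

Lemma polyfunX m k f : polyfun m f -> polyfun (k * m) (fun x => f x ^+ k).
Proof.
move=> pf; elim: k => [|k IH]; first exact: polyfun_cst.
have -> : (fun x => f x ^+ k.+1) = (fun x => f x * f x ^+ k).
  by apply/funext => x; rewrite exprS.
by rewrite mulSn; exact: polyfunM.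
Qed.

Lemma polyfunZ m (c : R) f : polyfun m f -> polyfun m (fun x => c * f x).
Proof. by move=> pf; apply: (@polyfunM 0 m) => //; exact: polyfun_cst. Qed.

Lemma polyfun_sum m (I : Type) (s : seq I) (P : pred I) (F : I -> pt -> R) :
  (forall i, P i -> polyfun m (F i)) ->
  polyfun m (fun x => \sum_(i <- s | P i) F i x).
Proof.
move=> pF; elim: s => [|i s IH].
  have -> : (fun x => \sum_(i <- [::] | P i) F i x) = cst 0.
    by apply/funext => x; rewrite big_nil.
  exact: polyfun_cst.
have -> : (fun x => \sum_(j <- i :: s | P j) F j x) =
  (fun x => (if P i then F i x else 0) + \sum_(j <- s | P j) F j x).
  by apply/funext => x; rewrite big_cons; case: ifP => // _; rewrite add0r.
apply: polyfunD => //; case: (boolP (P i)) => [Pi|_]; first exact: pF.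
exact: polyfun_cst.
Qed.

Lemma polyfun_poly2 m f : poly2 m f -> polyfun m f.
Proof.
move=> [c fE]; rewrite (funext fE).
apply: (@polyfun_sum m _ _ _ (fun (i : 'I_m.+1) x =>
  \sum_(j < m.+1 | (i + j <= m)%N) c i j * x.1 ^+ i * x.2 ^+ j)) => i _.
apply: (@polyfun_sum m _ _ _ (fun (j : 'I_m.+1) x =>
  c i j * x.1 ^+ i * x.2 ^+ j)) => j ij.
apply: (@polyfun_leq (i * 1 + j * 1)); first by rewrite !muln1.
have pX : polyfun 1 (fun x : pt => x.1).
  have -> : (fun x : pt => x.1) = dot (1, 0).
    by apply/funext => x; rewrite /dot /= mul1r mul0r addr0.
  exact: polyfun_dot.
have pY : polyfun 1 (fun x : pt => x.2).
  have -> : (fun x : pt => x.2) = dot (0, 1).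
    by apply/funext => x; rewrite /dot /= mul1r mul0r add0r.
  exact: polyfun_dot.
apply: polyfunM; last exact: polyfunX.
by apply: polyfunZ; exact: polyfunX.
Qed.

End PolynomialFunctions.

(** * Barycentric coordinates and subtriangles *)

Section Barycentric.
Context {R : realType}.
Local Notation pt := (R * R)%type.
Implicit Types (a b x y : pt) (i j k l : 'I_3).

(** Case analysis on indices modulo 3 in the canonical forms on which
    [ord3_next] and [ord3_prev] compute. *)
Lemma ord3_ind (P : 'I_3 -> Prop) : P 0 -> P 1 -> P 2%:R -> forall i, P i.
Proof.
move=> P0 P1 P2 [[|[|[|//]]] ?].
- by rewrite (_ : Ordinal _ = 0) //; exact: val_inj.
- by rewrite (_ : Ordinal _ = 1) //; exact: val_inj.
- by rewrite (_ : Ordinal _ = 2%:R) //; exact: val_inj.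
Qed.

Lemma ord3_next : (((0 + 1)%R = 1%R :> 'I_3) * ((1 + 1)%R = (2%:R)%R :> 'I_3) *
  ((2%:R + 1)%R = 0%R :> 'I_3))%type.
Proof. by split; [split|]; exact: val_inj. Qed.

Lemma ord3_prev : (((0 - 1)%R = (2%:R)%R :> 'I_3) * ((1 - 1)%R = 0%R :> 'I_3) *
  ((2%:R - 1)%R = 1%R :> 'I_3))%type.
Proof. by split; [split|]; exact: val_inj. Qed.

Lemma ord3_sum (V : nmodType) (F : 'I_3 -> V) :
  \sum_i F i = F 0 + F 1 + F 2%:R.
Proof.
rewrite !big_ord_recl big_ord0 addr0 addrA.
by congr (F _ + F _ + F _); exact: val_inj.
Qed.

Lemma hull_node N (q : 'I_N -> pt) (j : 'I_N) : hull q (q j).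
Proof.
exists (fun l : 'I_N => (l == j)%:R); split=> [l||]; first exact: ler0n.
  by rewrite (bigD1 j) //= eqxx big1 ?addr0 // => l /negbTE ->.
rewrite (bigD1 j) //= eqxx scale1r big1 ?addr0 // => l /negbTE ->.
by rewrite scale0r.
Qed.

Variable p : 'I_3 -> pt.

Lemma bary_den i : det2 (p (i + 1) - p i) (p (i - 1) - p i) = det_tri p.
Proof.
by elim/ord3_ind: i; rewrite ?ord3_next ?ord3_prev /det_tri /det2 /=; ring.
Qed.

Lemma bary_dot i x : bary p i x =
  dot ((det_tri p)^-1 *: ((p (i + 1)).2 - (p (i - 1)).2,
                          (p (i - 1)).1 - (p (i + 1)).1)) x +
  det2 (p (i + 1)) (p (i - 1)) / det_tri p.
Proof. by rewrite dotZl /bary bary_den /dot /det2 /=; ring. Qed.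

Lemma polyfun_bary i : polyfun 1 (bary p i).
Proof.
rewrite (funext (bary_dot i)); apply: polyfunD; first exact: polyfun_dot.
exact: polyfun_cst.
Qed.

Lemma bary_continuous i : continuous (bary p i).
Proof.
move=> x; have [g [_ G _ _]] := polyfun_bary i.
by have [/differentiable_continuous] := has_grad_differentiable (G x).
Qed.

Lemma affine_comb N (q : 'I_N -> pt) (t : 'I_N -> R) g (c : R) :
  \sum_i t i = 1 ->
  dot g (\sum_i t i *: q i) + c = \sum_i t i * (dot g (q i) + c).
Proof.
move=> t1; under [RHS]eq_bigr do rewrite mulrDr.
rewrite big_split /= -mulr_suml t1 mul1r; congr (_ + c).
elim/big_rec2: _ => [|i y1 y2 _ IH]; first by rewrite dot0r.
by rewrite dotDr dotZr IH.
Qed.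

Lemma bary_comb N (q : 'I_N -> pt) (t : 'I_N -> R) i :
  \sum_j t j = 1 -> bary p i (\sum_j t j *: q j) = \sum_j t j * bary p i (q j).
Proof.
by move=> t1; rewrite bary_dot affine_comb //; under eq_bigr do rewrite -bary_dot.
Qed.

Hypothesis dp : det_tri p != 0.

Lemma bary_node i j : bary p i (p j) = (i == j)%:R.
Proof.
rewrite /bary bary_den; move: dp; rewrite /det_tri.
elim/ord3_ind: i; elim/ord3_ind: j => dp';
  rewrite ?ord3_next ?ord3_prev /= ?subrr /det2 /= ?mulr0 ?mul0r ?subrr ?mul0r //;
  move: dp'; rewrite /det2 /= => dp'; field => //.
Qed.

Lemma bary_sum x : \sum_i bary p i x = 1.
Proof.
rewrite ord3_sum /bary !bary_den -!mulrDl ?ord3_next ?ord3_prev.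
move: dp; rewrite /det_tri /det2 /= => dp'; field => //.
Qed.

Lemma bary_recomb x : \sum_i bary p i x *: p i = x.
Proof.
rewrite ord3_sum /bary !bary_den ?ord3_next ?ord3_prev.
move: dp; rewrite /det_tri /det2 /= => dp'.
by rewrite [RHS]surjective_pairing; congr (_, _); rewrite /= /GRing.scale /=; field.
Qed.

Lemma bary_hull N (q : 'I_N -> pt) x i : (forall j : 'I_N, 0 <= bary p i (q j)) ->
  hull q x -> 0 <= bary p i x.
Proof.
move=> q0 [t [t0 t1 ->]]; rewrite bary_comb //.
by apply: sumr_ge0 => j _; rewrite mulr_ge0.
Qed.

Lemma hullP x : hull p x <-> forall i, 0 <= bary p i x.
Proof.
split=> [hx i|x0]; last by exists (fun i => bary p i x); rewrite bary_recomb bary_sum.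
by apply: bary_hull hx => j; rewrite bary_node.
Qed.

Lemma bary_barycenter i : bary p i (barycenter p) = 3^-1.
Proof.
have -> : barycenter p = \sum_j 3^-1 *: p j by rewrite /barycenter scaler_sumr.
rewrite bary_comb; last by rewrite ord3_sum; field.
rewrite (bigD1 i) //= big1 => [|j ji]; last by rewrite bary_node eq_sym (negbTE ji) mulr0.
by rewrite bary_node eqxx mulr1 addr0.
Qed.

(** A convex combination of the vertices of the [k]-th subtriangle with weights
    [t] has [lambda_k = t_k / 3] and [lambda_l = t_l + t_k / 3] for [l] different
    from [k]; conversely the weights are [3 lambda_k] and
    [lambda_l - lambda_k]. *)
Lemma subtriP k x : subtri p k x <-> forall l, 0 <= bary p k x <= bary p l x.
Proof.
split=> [[t [t0 t1 ->]] l|kx].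
  rewrite !bary_comb //; apply/andP; split.
    apply: sumr_ge0 => j _; rewrite mulr_ge0 //.
    by case: eqP => _; rewrite ?bary_barycenter ?bary_node ?invr_ge0.
  apply: ler_sum => j _; rewrite ler_wpM2l //.
  case: (eqVneq j k) => [_|jk]; first by rewrite !bary_barycenter.
  by rewrite !bary_node eq_sym (negbTE jk) ler0n.
pose t j := if j == k then 3 * bary p k x else bary p j x - bary p k x.
have tE (V : lmodType R) (F : 'I_3 -> V) v : \sum_j t j *: (if j == k then v else F j) =
    (3 * bary p k x) *: v + \sum_j (bary p j x - bary p k x) *: F j.
  rewrite (bigD1 k) //= [X in _ = _ + X](bigD1 k) //= /t !eqxx subrr scale0r add0r.
  by congr (_ + _); apply: eq_bigr => j /negbTE ->.
exists t; split.
- move=> j; rewrite /t; case: eqP => _; have /andP[k0 kj] := kx j.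
    by rewrite mulr_ge0.
  by rewrite subr_ge0.
- have := tE R^o (fun=> 1) 1; under eq_bigr do rewrite if_same.
  have e (F : 'I_3 -> R) : \sum_j F j *: (1 : R^o) = \sum_j F j.
    by apply: eq_bigr => j _; rewrite /GRing.scale /= mulr1.
  rewrite !e => ->; rewrite sumrB bary_sum sumr_const card_ord /GRing.scale /=.
  by rewrite -mulr_natr; ring.
- rewrite tE /barycenter scalerA mulrAC divff ?pnatr_eq0 // mul1r.
  have -> : \sum_j (bary p j x - bary p k x) *: p j =
      x - bary p k x *: \sum_j p j.
    under eq_bigr do rewrite scalerBl.
    by rewrite sumrB bary_recomb scaler_sumr.
  by rewrite addrC subrK.
Qed.

Lemma subtri_hull k x : subtri p k x -> hull p x.
Proof.
by move=> /subtriP kx; apply/hullP => i; have /andP[] := kx i; exact: le_trans.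
Qed.

Lemma hull_subtri x : hull p x -> exists k, subtri p k x.
Proof.
move=> /hullP x0.
case: (@Order.TotalTheory.arg_minP _ _ 'I_3 0 xpredT (fun i => bary p i x)) => //.
by move=> k _ kmin; exists k; apply/subtriP => l; rewrite x0 kmin.
Qed.

Lemma closed_hull : closed (hull p).
Proof.
have -> : hull p = \bigcap_i (bary p i @^-1` [set r | 0 <= r]).
  apply/seteqP; split=> x; first by move=> /hullP + i _; exact.
  by move=> H; apply/hullP => i; exact: H.
apply: closed_bigI => i _; apply: (proj1 (continuous_closedP _)); last exact: closed_ge.
exact: bary_continuous.
Qed.

Lemma closed_subtri k : closed (subtri p k).
Proof.
have -> : subtri p k = hull p `&`
    \bigcap_i ((fun x => bary p i x - bary p k x) @^-1` [set r | 0 <= r]).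
  apply/seteqP; split=> x.
    move=> kx; split; first exact: subtri_hull kx.
    by move=> i _ /=; rewrite subr_ge0; move/subtriP: kx => /(_ i) /andP[].
  move=> [/hullP x0 H]; apply/subtriP => l; rewrite x0 /=.
  by have := H l I; rewrite /= subr_ge0.
apply: closedI; first exact: closed_hull.
apply: closed_bigI => i _; apply: (proj1 (continuous_closedP _)); last exact: closed_ge.
by move=> x; apply: (@cvgB _ _ _ (nbhs x)); exact: bary_continuous.
Qed.

Lemma bary_seg i a b (t : R) :
  bary p i (seg_path a b t) = (1 - t) * bary p i a + t * bary p i b.
Proof. by rewrite !bary_dot /seg_path !dotDr !dotZr; ring. Qed.

(** On the edge opposite to vertex [k] the coordinate [lambda_k] is zero, hence
    minimal. *)
Lemma edge_subtri k (t : R) : 0 <= t <= 1 ->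
  subtri p k (seg_path (p (k + 1)) (p (k - 1)) t).
Proof.
move=> /andP[t0 t1]; apply/subtriP => l; rewrite !bary_seg !bary_node.
have -> : (k == k + 1) = false by elim/ord3_ind: k.
have -> : (k == k - 1) = false by elim/ord3_ind: k.
by rewrite !mulr0 addr0 lexx addr_ge0 // mulr_ge0 // subr_ge0.
Qed.

Lemma vertices_neq k : p (k + 1) != p (k - 1).
Proof.
apply/eqP => e; have := bary_node (k + 1) (k + 1); rewrite e bary_node eqxx.
by elim/ord3_ind: k {e} => /eqP; rewrite eq_sym oner_eq0.
Qed.

Lemma hull_affine_seg x i : hull p x ->
  forall t : R, 0 <= t <= 1 -> hull p (x + t *: (p i - x)).
Proof.
move=> /hullP x0 t /andP[t0 t1]; have -> : x + t *: (p i - x) = seg_path x (p i) t.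
  by rewrite /seg_path scalerBr scalerBl scale1r addrCA addrC.
by apply/hullP => l; rewrite bary_seg bary_node addr_ge0 // mulr_ge0 // subr_ge0.
Qed.

(** The directions from [x] to the three vertices stay in the triangle and span
    the plane, even when [x] is itself a vertex. *)
Lemma has_grad_hull_unique f x g g' : hull p x ->
  has_grad_on (hull p) f x g -> has_grad_on (hull p) f x g' -> g = g'.
Proof.
move=> hx G G'.
have E i : dot g (p i - x) = dot g' (p i - x).
  exact: has_grad_dir (hull_affine_seg i hx) G G'.
have E' i j : dot g (p i - p j) = dot g' (p i - p j).
  by rewrite -(subrK x (p i)) -addrA -(opprB (p j)) !(dotBr (p i - x)) !E.
by apply: dot_sep (E' 1 0) (E' 2%:R 0); exact: dp.
Qed.

Lemma grad_on_hull f x g : hull p x -> has_grad_on (hull p) f x g ->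
  grad_on (hull p) f x = g.
Proof.
move=> hx G; apply: (has_grad_hull_unique hx _ G); rewrite /grad_on.
by apply: getPex; exists g.
Qed.

End Barycentric.

(** * The local space as a C^1 spline on the refined triangle *)

Section RefinedTriangle.
Context {R : realType}.
Local Notation pt := (R * R)%type.
Implicit Types (a b x y : pt) (f : pt -> R) (i j k l : 'I_3).

(** The affine function that [lambda_i^R] coincides with on the [k]-th
    subtriangle, given on the whole plane. *)
Definition piece_coord (p : 'I_3 -> pt) k i x : R := bary p i x - bary p k x.

Variable p : 'I_3 -> pt.
Hypothesis dp : det_tri p != 0.

(** Both sides are affine on the subtriangle and agree at its vertices. *)
Lemma refined_bary_subtri lR k i x : refined_bary p lR ->
  subtri p k x -> lR i x = piece_coord p k i x.
Proof.
move=> rb kx; have [_ aff lRn lRc] := rb i.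
have [g [c lRE]] := aff k; rewrite lRE //.
have [t [t0 t1 xE]] := kx; rewrite xE affine_comb // /piece_coord !bary_comb //.
rewrite -sumrB; apply: eq_bigr => j _; rewrite -mulrBr; congr (_ * _).
have qj : subtri p k (if j == k then barycenter p else p j).
  exact: hull_node.
rewrite -lRE //; case: (eqVneq j k) => [_|jk].
  by rewrite lRc !bary_barycenter ?subrr.
by rewrite lRn !bary_node // [k == j]eq_sym (negbTE jk) subr0 eq_sym.
Qed.

Definition min_bary x : R :=
  Num.min (bary p 0 x) (Num.min (bary p 1 x) (bary p 2%:R x)).

Lemma min_bary_subtri k x : subtri p k x -> min_bary x = bary p k x.
Proof.
move=> /(subtriP dp) kx; apply/le_anti/andP; split; rewrite /min_bary.
  by elim/ord3_ind: k kx => _; rewrite !ge_min lexx ?orbT.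
rewrite !le_min.
by have /andP[_ ->] := kx 0; have /andP[_ ->] := kx 1; have /andP[_ ->] := kx 2%:R.
Qed.

(** The [k]-th coordinate is the smallest one on the [k]-th subtriangle, so
    subtracting the minimum subtracts [lambda_k] there, while continuity is
    clear. *)
Lemma refined_bary_exists : exists lR, refined_bary p lR.
Proof.
exists (fun i x => bary p i x - min_bary x) => i; split.
- apply: continuous_subspaceT => x; apply: (@cvgB _ _ _ (nbhs x)).
    exact: bary_continuous.
  by apply: continuous_min; [|apply: continuous_min]; exact: bary_continuous.
- move=> k; have [gi [ci Ei]] : affine_on setT (bary p i).
    by eexists; eexists => x _; exact: bary_dot.
  have [gk [ck Ek]] : affine_on setT (bary p k).
    by eexists; eexists => x _; exact: bary_dot.
  exists (gi - gk), (ci - ck) => x kx.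
  by rewrite (min_bary_subtri kx) Ei // Ek // dotBl; ring.
- move=> j; rewrite bary_node // eq_sym.
  have jn : (j + 1 == j) = false by elim/ord3_ind: j.
  rewrite (@min_bary_subtri (j + 1)) ?bary_node ?jn ?subr0 //.
  by apply/subtriP => // l; rewrite !bary_node // jn lexx ler0n.
- rewrite (@min_bary_subtri 0) ?bary_barycenter ?subrr //.
  by apply/subtriP => // l; rewrite !bary_barycenter // lexx invr_ge0 ler0n.
Qed.

Variable nrm : 'I_3 -> pt.

Lemma eq_w lR lR' i x : (forall j, lR j x = lR' j x) ->
  w p nrm lR i x = w p nrm lR' i x.
Proof. by move=> E; rewrite /w /v_prev /v_next !E. Qed.

(** The two elements may come with different refined coordinates, but those agree
    on the triangle. *)
Lemma U3_linear (c : R) f h : U3 p nrm f -> U3 p nrm h ->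
  U3 p nrm (fun x => c * f x + h x).
Proof.
move=> [lR [q [a [rb [cq qE] fE]]]] [lR' [q' [a' [rb' [cq' qE'] hE]]]].
exists lR, (fun x => c * q x + q' x), (fun i => c * a i + a' i); split => //.
  exists (fun i j : nat => c * cq i j + cq' i j) => x.
  rewrite qE qE' mulr_sumr -big_split /=; apply: eq_bigr => i _.
  rewrite mulr_sumr -big_split /=; apply: eq_bigr => j _; by ring.
move=> x hx; rewrite fE // hE //; have [k kx] := hull_subtri dp hx.
have -> : \sum_i (c * a i + a' i) * w p nrm lR i x =
    c * (\sum_i a i * w p nrm lR i x) + \sum_i a' i * w p nrm lR' i x.
  rewrite mulr_sumr -big_split /=; apply: eq_bigr => i _.
  rewrite (@eq_w lR' lR i x); first by ring.
  by move=> j; rewrite !(refined_bary_subtri _ _ kx).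
by ring.
Qed.

Lemma U3_0 : U3 p nrm (fun=> 0).
Proof.
have [lR rb] := refined_bary_exists; exists lR, (fun=> 0), (fun=> 0); split => //.
  exists (fun _ _ => 0) => x; rewrite big1 // => i _; rewrite big1 // => j _.
  by rewrite !mul0r.
by move=> x _; rewrite big1 ?addr0 // => i _; rewrite mul0r.
Qed.

Lemma polyfun_baryB i j : polyfun 1 (fun x => bary p i x - bary p j x).
Proof.
have -> : (fun x => bary p i x - bary p j x) =
    (fun x => bary p i x + (-1) * bary p j x).
  by apply/funext => x; rewrite mulN1r.
by apply: polyfunD; [|apply: polyfunZ]; exact: polyfun_bary.
Qed.

Lemma polyfun_piece q (a : 'I_3 -> R) k : poly2 3 q ->
  polyfun 3 (fun x => q x + \sum_i a i * w p nrm (piece_coord p k) i x).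
Proof.
move=> /polyfun_poly2 pq; apply: polyfunD => //.
have pB i : polyfun 1 (bary p i) := polyfun_bary p i.
have pBB i j := polyfun_baryB i j.
have pbub : polyfun 3 (fun x => bubble p x).
  by apply: (@polyfunM _ 2 1) => //; apply: (@polyfunM _ 1 1).
have pv i : polyfun 3 (fun x => C_T p / 2 *
    (piece_coord p k i x ^+ 2 - bary p i x ^+ 2) *
    (bary p (i - 1) x - bary p (i + 1) x)).
  apply: (@polyfunM _ 2 1) => //; apply: polyfunZ.
  have -> : (fun x => piece_coord p k i x ^+ 2 - bary p i x ^+ 2) =
     (fun x => piece_coord p k i x ^+ 2 + (-1) * bary p i x ^+ 2).
    by apply/funext => x; rewrite mulN1r.
  apply: polyfunD; first by apply: (@polyfunX _ 1 2); exact: pBB.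
  by apply: polyfunZ; apply: (@polyfunX _ 1 2).
apply: polyfun_sum => i _; apply: polyfunZ; apply: polyfunZ.
have -> : (fun x => v_prev p (piece_coord p k) (i + 1) x -
    v_next p (piece_coord p k) (i - 1) x) = (fun x =>
   (C_T p / 2 * (piece_coord p k (i + 1) x ^+ 2 - bary p (i + 1) x ^+ 2) *
    (bary p (i + 1 - 1) x - bary p (i + 1 + 1) x)) + ((-1) *
   (C_T p / 2 * (piece_coord p k (i - 1) x ^+ 2 - bary p (i - 1) x ^+ 2) *
    (bary p (i - 1 - 1) x - bary p (i - 1 + 1) x)) +
    (2 * C_T p) * bubble p x)).
  by apply/funext => x; rewrite /v_prev /v_next; ring.
apply: polyfunD; first exact: pv.
by apply: polyfunD; apply: polyfunZ; [exact: pv|].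
Qed.

(** The C^1 property across the interfaces of the refinement: the difference of
    two pieces is a product of two functions that both vanish where
    [lambda_k = lambda_l], so its gradient is zero there. *)
Lemma U3_pieces f : U3 p nrm f ->
  exists (P : 'I_3 -> pt -> R) (g : 'I_3 -> pt -> pt),
   [/\ forall k, poly_with_grad 3 (P k) (g k),
       forall k x, subtri p k x -> f x = P k x &
       forall k l x, subtri p k x -> subtri p l x -> g k x = g l x].
Proof.
move=> [lR [q [a [rb pq fE]]]].
pose P k x := q x + \sum_i a i * w p nrm (piece_coord p k) i x.
have /choice[g gP] : forall k, exists gk, poly_with_grad 3 (P k) gk.
  by move=> k; exact: polyfun_piece.
exists P, g; split => // [k x kx|k l x kx lx].
  rewrite fE; last exact: subtri_hull kx.
  congr (_ + _); apply: eq_bigr => i _; congr (_ * _).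
  by apply: eq_w => j; exact: refined_bary_subtri.
have kl : bary p k x = bary p l x.
  move: kx lx => /(subtriP dp) kx /(subtriP dp) lx; apply/le_anti.
  by have /andP[_ ->] := kx l; have /andP[_ ->] := lx k.
have [->//|knl] := eqVneq k l.
(* From (u - v)^2 - (u - w)^2 = (v - w) (v + w - 2 u): the difference of the
   v_{i,j} on the two pieces is (lambda_k - lambda_l) V_i. *)
pose V i y := C_T p / 2 * ((bary p k y + bary p l y - 2 * bary p i y) *
  (bary p (i - 1) y - bary p (i + 1) y)).
pose Q y := \sum_i a i * ((4 * C_T p * c_diag p nrm i)^-1 * (V (i + 1) y - V (i - 1) y)).
have PE : P k = (fun y => P l y + (bary p k y - bary p l y) * Q y).
  apply/funext => y; rewrite /P /Q mulr_sumr -addrA -big_split /=; congr (_ + _).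
  apply: eq_bigr => i _; rewrite /w /v_prev /v_next /V /piece_coord; ring.
(* If i is k or l the first factor of V_i vanishes at x; otherwise k and l are
   the two neighbours of i and the second one does. *)
have Vx i : V i x = 0.
  rewrite /V; apply/eqP; rewrite mulf_eq0; apply/orP; right; apply/eqP.
  move: kl knl; clear; elim/ord3_ind: i; elim/ord3_ind: k; elim/ord3_ind: l => //;
  rewrite ?ord3_next ?ord3_prev => -> _; ring.
have Qx : Q x = 0.
  by rewrite /Q big1 // => i _; rewrite !Vx subrr !mulr0.
have pV i : polyfun 2 (V i).
  apply: polyfunZ; apply: (@polyfunM _ 1 1); last exact: polyfun_baryB.
  have -> : (fun y => bary p k y + bary p l y - 2 * bary p i y) =
     (fun y => (bary p k y - bary p i y) + (bary p l y - bary p i y)).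
    by apply/funext => y; ring.
  by apply: polyfunD; exact: polyfun_baryB.
have [gQ [_ QG _ _]] : polyfun 2 Q.
  apply: polyfun_sum => i _; apply: polyfunZ; apply: polyfunZ.
  have -> : (fun y => V (i + 1) y - V (i - 1) y) =
     (fun y => V (i + 1) y + (-1) * V (i - 1) y).
    by apply/funext => y; rewrite mulN1r.
  by apply: polyfunD => //; exact: polyfunZ.
have [gB [_ BG _ _]] := polyfun_baryB k l.
have [_ PlG _ _] := gP l; have [_ PkG _ _] := gP k.
apply: (has_grad_unique (PkG x)); rewrite PE.
have := has_gradD (PlG x) (has_gradM (BG x) (QG x)).
by rewrite Qx kl subrr !scale0r !addr0.
Qed.

End RefinedTriangle.

(** * Polynomials of low degree on a segment *)

Section SegmentPolynomials.
Context {R : realType}.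
Local Notation pt := (R * R)%type.
Implicit Types (a b x y n : pt) (f h : pt -> R) (k l : 'I_3).

Lemma seg_path0 a b : seg_path a b 0 = a.
Proof. by rewrite /seg_path subr0 scale1r scale0r addr0. Qed.

Lemma seg_path1 a b : seg_path a b 1 = b.
Proof. by rewrite /seg_path subrr scale1r scale0r add0r. Qed.

Lemma seg_path_rev a b t : seg_path a b t = seg_path b a (1 - t).
Proof. by rewrite /seg_path subKr addrC. Qed.

Lemma seg_pathB a b (s t : R) : seg_path a b t - seg_path a b s = (t - s) *: (b - a).
Proof.
by rewrite [LHS]surjective_pairing; congr (_, _);
  rewrite /seg_path /= /GRing.scale /=; ring.
Qed.

(** Each of the two segments has its direction a multiple of the other one by a
    factor of modulus at most 1; the product of the factors is 1, so both are 1
    or both are -1. *)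
Lemma segm_endpoints a b c d : a != b -> segm a b = segm c d ->
  (c = a /\ d = b) \/ (c = b /\ d = a).
Proof.
move=> ab E.
have in0 : (0 : R) \in `[0, 1] by rewrite in_itv /= lexx ler01.
have in1 : (1 : R) \in `[0, 1] by rewrite in_itv /= ler01 lexx.
have [s s01 sE] : segm c d a by rewrite -E; exists 0; rewrite ?seg_path0.
have [t t01 tE] : segm c d b by rewrite -E; exists 1; rewrite ?seg_path1.
have [s' s01' sE'] : segm a b c by rewrite E; exists 0; rewrite ?seg_path0.
have [t' t01' tE'] : segm a b d by rewrite E; exists 1; rewrite ?seg_path1.
have e1 : b - a = (t - s) *: (d - c) by rewrite -seg_pathB tE sE.
have e2 : d - c = (t' - s') *: (b - a) by rewrite -seg_pathB tE' sE'.
have u1 : (t - s) * (t' - s') = 1.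
  have : (1 - (t - s) * (t' - s')) *: (b - a) = 0.
    by rewrite scalerBl scale1r -scalerA -e2 -e1 subrr.
  move/eqP; rewrite scaler_eq0 subr_eq0 [_ == 0]subr_eq0 [b == a]eq_sym (negbTE ab) orbF.
  by move/eqP.
move: s01 t01 s01' t01'; rewrite /= !in_itv /=.
move=> /andP[? ?] /andP[? ?] /andP[? ?] /andP[? ?].
have [ts|ts] := leP 0 (t - s).
  have s0 : s = 0 by nra.
  have t1 : t = 1 by nra.
  by left; rewrite -sE -tE s0 t1 seg_path0 seg_path1.
have s0 : s = 1 by nra.
have t1 : t = 0 by nra.
by right; rewrite -sE -tE s0 t1 seg_path0 seg_path1.
Qed.

Lemma horner_size4 (q : {poly R}) t : (size q <= 4)%N ->
  q.[t] = q`_0 + q`_1 * t + q`_2 * t ^+ 2 + q`_3 * t ^+ 3 /\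
  q^`().[t] = q`_1 + 2 * q`_2 * t + 3 * q`_3 * t ^+ 2.
Proof.
move=> sq; split.
  by rewrite (horner_coef_wide _ sq) !big_ord_recl big_ord0 /= /bump /=; ring.
have sq' : (size q^`() <= 3)%N.
  by rewrite (leq_trans (size_poly _ _)) //; case: (size q) sq.
rewrite (horner_coef_wide _ sq') !big_ord_recl big_ord0 /= /bump /= !coef_deriv.
by ring.
Qed.

Lemma hermite_unique (q r : {poly R}) : (size q <= 4)%N -> (size r <= 4)%N ->
  q.[0] = r.[0] -> q.[1] = r.[1] -> q^`().[0] = r^`().[0] ->
  q^`().[1] = r^`().[1] -> q = r.
Proof.
move=> sq sr.
have [-> ->] := horner_size4 0 sq; have [-> ->] := horner_size4 1 sq.
have [-> ->] := horner_size4 0 sr; have [-> ->] := horner_size4 1 sr.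
rewrite !expr0n /= !expr1n !mulr0 !addr0 !mulr1 => e0 e1 d0 d1.
apply/polyP => -[|[|[|[|i]]]]; [lra|lra|lra|lra|].
by rewrite !nth_default // (leq_trans _ (leq_addr i 4)).
Qed.

Lemma simpson (r : {poly R}) : (size r <= 3)%N ->
  \int[@lebesgue_measure R]_(t in `[0, 1]) r.[t] =
  (r.[0] + 4 * r.[1 / 2] + r.[1]) / 6.
Proof.
move=> sr.
pose Q := \poly_(i < 4) (if i == 0%N then 0 else r`_i.-1 / i%:R).
have sQ : (size Q <= 4)%N by exact: size_poly.
have Q' : Q^`() = r.
  apply/polyP => i; rewrite coef_deriv coef_poly /= ltnS.
  case: ltnP => i3; last by rewrite mul0rn nth_default // (leq_trans sr).
  by rewrite -[LHS]mulr_natr divfK // pnatr_eq0.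
rewrite /Rintegral (@continuous_FTC2 _ _ (horner Q) 0 1) //=.
- have [-> _] := horner_size4 0 sQ; have [-> _] := horner_size4 1 sQ.
  have sr4 : (size r <= 4)%N by exact: leq_trans sr _.
  have [-> _] := horner_size4 0 sr4; have [-> _] := horner_size4 1 sr4.
  have [-> _] := horner_size4 (1 / 2) sr4.
  rewrite !coef_poly /= (nth_default 0 sr); by field.
- by apply: continuous_subspaceT => x; exact: continuous_horner.
- split=> [x _||].
  + exact: derivable_horner.
  + by apply: cvg_at_right_filter; exact: continuous_horner.
  + by apply: cvg_at_left_filter; exact: continuous_horner.
- by move=> x _; rewrite -derivE Q'.
Qed.

(** Simpson's rule turns the edge degrees of freedom into linear expressions in
    three point values; no integrability argument is needed afterwards, and the
    independence of the orientation of the edge is visible. *)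
Lemma segm_integral_simpson a b h : poly_on_segm 2 a b h ->
  segm_integral a b h = Num.sqrt (dot (b - a) (b - a)) *
    ((h a + 4 * h (seg_path a b (1 / 2)) + h b) / 6).
Proof.
move=> [r sr hr]; rewrite /segm_integral; congr (_ * _).
have -> : h a = r.[0] by rewrite -hr ?seg_path0 // in_itv /= lexx ler01.
have -> : h b = r.[1] by rewrite -hr ?seg_path1 // in_itv /= lexx ler01.
rewrite hr; last by rewrite in_itv /=; lra.
rewrite -simpson //; apply: eq_Rintegral => t.
by rewrite inE /= => /hr.
Qed.

Lemma segm_integral_linear (c : R) a b h h' f :
  poly_on_segm 2 a b h -> poly_on_segm 2 a b h' ->
  (forall t : R, 0 <= t <= 1 ->
     f (seg_path a b t) = c * h (seg_path a b t) + h' (seg_path a b t)) ->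
  segm_integral a b f = c * segm_integral a b h + segm_integral a b h'.
Proof.
move=> ph ph' fE; rewrite !segm_integral_simpson //; last first.
  have [q sq hq] := ph; have [q' sq' hq'] := ph'.
  exists (c *: q + q') => [|t t01].
    rewrite (leq_trans (size_polyD _ _)) // geq_max sq' andbT.
    exact: leq_trans (size_scale_leq _ _) sq.
  by rewrite fE ?hq ?hq' ?hornerD ?hornerZ //; move: t01; rewrite in_itv.
have fa : f a = c * h a + h' a by rewrite -(seg_path0 a b) fE // lexx ler01.
have fb : f b = c * h b + h' b by rewrite -(seg_path1 a b) fE // lexx ler01.
rewrite fa fb fE; first by ring.
by lra.
Qed.

Lemma quadratic_unique (q r : {poly R}) : (size q <= 3)%N -> (size r <= 3)%N ->
  q.[0] = r.[0] -> q.[1] = r.[1] -> q.[1 / 2] = r.[1 / 2] -> q = r.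
Proof.
move=> sq sr.
have sq4 : (size q <= 4)%N by exact: leq_trans sq _.
have sr4 : (size r <= 4)%N by exact: leq_trans sr _.
have q3 := nth_default 0 sq; have r3 := nth_default 0 sr.
have [-> _] := horner_size4 0 sq4; have [-> _] := horner_size4 1 sq4.
have [-> _] := horner_size4 0 sr4; have [-> _] := horner_size4 1 sr4.
have [-> _] := horner_size4 (1 / 2) sq4; have [-> _] := horner_size4 (1 / 2) sr4.
rewrite q3 r3 !expr0n /= !expr1n !mulr0 !mulr1 !mul0r !addr0 => e0 e1 e2.
apply/polyP => -[|[|[|i]]]; [lra|nra|nra|].
by rewrite !nth_default // (leq_trans _ (leq_addr i 3)).
Qed.

End SegmentPolynomials.

(** * Traces and normal derivatives on an edge *)

Section LocalRegularity.
Context {R : realType}.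
Local Notation pt := (R * R)%type.
Implicit Types (a b x y n : pt) (f h : pt -> R) (p : 'I_3 -> pt) (k l : 'I_3).

(** The pieces of [f] have the same gradients on the interfaces, so they glue to a
    gradient of [f] relative to the whole triangle, boundary included. *)
Lemma U3_spline p nrm f : det_tri p != 0 -> U3 p nrm f ->
  exists (P : 'I_3 -> pt -> R) (g : 'I_3 -> pt -> pt),
   [/\ forall k, poly_with_grad 3 (P k) (g k),
       forall k x, subtri p k x -> f x = P k x &
       forall k x, subtri p k x -> has_grad_on (hull p) f x (g k x)].
Proof.
move=> dp /(U3_pieces dp)[P [g [Pg fP gE]]]; exists P, g; split => // k x kx.
apply: (@has_grad_glue _ _ (subtri p)).
- by move=> y /(hull_subtri dp)[l ly]; exists l.
- exact: closed_subtri.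
move=> l lx; rewrite (gE _ _ _ kx lx); have [_ PG _ _] := Pg l.
apply: eq_has_grad lx _ (sub_has_grad (@subsetT _ _) (PG x)) => y.
by rewrite inE => ly; rewrite (fP l).
Qed.

Lemma U3_has_grad p nrm f x : det_tri p != 0 -> U3 p nrm f -> hull p x ->
  has_grad_on (hull p) f x (grad_on (hull p) f x).
Proof.
move=> dp fU hx; have [P [g [_ _ G]]] := U3_spline dp fU.
have [k kx] := hull_subtri dp hx.
by rewrite (grad_on_hull dp hx (G _ _ kx)); exact: G.
Qed.

Lemma U3_grad_linear p nrm (c : R) f h x : det_tri p != 0 ->
  U3 p nrm f -> U3 p nrm h -> hull p x ->
  grad_on (hull p) (fun y => c * f y + h y) x =
  c *: grad_on (hull p) f x + grad_on (hull p) h x.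
Proof.
move=> dp fU hU hx; apply: grad_on_hull => //.
by apply: has_grad_linear; [exact: (U3_has_grad dp fU)|exact: (U3_has_grad dp hU)].
Qed.

Lemma grad_on_cst0 p x : det_tri p != 0 -> hull p x ->
  grad_on (hull p) (fun=> 0) x = 0.
Proof. by move=> dp hx; apply: grad_on_hull => //; exact: has_grad_cst. Qed.

Lemma U3_trace p nrm f k a b : det_tri p != 0 -> U3 p nrm f ->
  (forall t : R, 0 <= t <= 1 -> subtri p k (seg_path a b t)) ->
  exists2 q : {poly R}, (size q <= 4)%N & forall t, 0 <= t <= 1 ->
    f (seg_path a b t) = q.[t] /\
    dot (grad_on (hull p) f (seg_path a b t)) (b - a) = q^`().[t].
Proof.
move=> dp fU kab; have [P [g [Pg fP G]]] := U3_spline dp fU.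
have [_ _ /(_ a b)[q sq Q] _] := Pg k; exists q => // t /kab kt.
rewrite (grad_on_hull dp (subtri_hull dp kt) (G _ _ kt)) (fP _ _ kt).
exact: Q.
Qed.

Lemma U3_dnormal p nrm f k a b n : det_tri p != 0 -> U3 p nrm f ->
  (forall t : R, 0 <= t <= 1 -> subtri p k (seg_path a b t)) ->
  poly_on_segm 2 a b (dnormal p n f).
Proof.
move=> dp fU kab; have [P [g [Pg fP G]]] := U3_spline dp fU.
have [_ _ _ /(_ a b n)[q sq Q]] := Pg k; exists q => // t.
rewrite in_itv /= => /kab kt.
by rewrite /dnormal (grad_on_hull dp (subtri_hull dp kt) (G _ _ kt)).
Qed.

(** The traces from both sides are cubics with the same Hermite data at the ends,
    which settles the values and the tangential derivative; together with the
    normal derivative this is the whole gradient. *)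
Lemma U3_edge_match p p' nrm nrm' f f' k k' a b n :
  det_tri p != 0 -> det_tri p' != 0 -> U3 p nrm f -> U3 p' nrm' f' ->
  a != b -> unit_normal a b n ->
  (forall t : R, 0 <= t <= 1 -> subtri p k (seg_path a b t)) ->
  (forall t : R, 0 <= t <= 1 -> subtri p' k' (seg_path a b t)) ->
  f a = f' a -> f b = f' b ->
  grad_on (hull p) f a = grad_on (hull p') f' a ->
  grad_on (hull p) f b = grad_on (hull p') f' b ->
  (forall t : R, 0 <= t <= 1 ->
    dnormal p n f (seg_path a b t) = dnormal p' n f' (seg_path a b t)) ->
  forall t : R, 0 <= t <= 1 ->
    f (seg_path a b t) = f' (seg_path a b t) /\
    grad_on (hull p) f (seg_path a b t) = grad_on (hull p') f' (seg_path a b t).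
Proof.
move=> dp dp' fU fU' ab [nn nab] kab kab' fa fb ga gb nE t t01.
have [q sq Q] := U3_trace dp fU kab.
have [q' sq' Q'] := U3_trace dp' fU' kab'.
have z01 : 0 <= (0 : R) <= 1 by rewrite lexx ler01.
have o01 : 0 <= (1 : R) <= 1 by rewrite lexx ler01.
have qq' : q = q'.
  have := Q _ z01; have := Q' _ z01; have := Q _ o01; have := Q' _ o01.
  rewrite seg_path0 seg_path1 fa fb ga gb.
  move=> [e1 d1] [e2 d2] [e3 d3] [e4 d4].
  by apply: hermite_unique; rewrite -?e1 -?e3 -?d1 -?d3.
have [e1 d1] := Q _ t01; have [e2 d2] := Q' _ t01.
split; first by rewrite e1 e2 qq'.
apply: (@dot_sep _ (b - a) n); last 2 first.
- by rewrite d1 d2 qq'.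
- exact: nE.
(* The unit normal and the direction d of the edge are independent: d is
   recovered from n.d and det (d, n), which would both be zero. *)
move: nn nab; rewrite /det2 /dot => nn nab; apply/eqP => D.
move/eqP: ab; apply; symmetry; apply/eqP; rewrite -subr_eq0; apply/eqP.
rewrite [LHS]surjective_pairing; set d := b - a in nab D *.
have E1 : d.1 = 0.
  transitivity (d.1 * (n.1 * n.1 + n.2 * n.2)); first by rewrite nn mulr1.
  transitivity (n.1 * (n.1 * d.1 + n.2 * d.2) + n.2 * (d.1 * n.2 - d.2 * n.1)).
    by ring.
  by rewrite nab D !mulr0 addr0.
have E2 : d.2 = 0.
  transitivity (d.2 * (n.1 * n.1 + n.2 * n.2)); first by rewrite nn mulr1.
  transitivity (n.2 * (n.1 * d.1 + n.2 * d.2) - n.1 * (d.1 * n.2 - d.2 * n.1)).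
    by ring.
  by rewrite nab D !mulr0 subr0.
by rewrite E1 E2.
Qed.

End LocalRegularity.

(** * Gluing over the mesh *)

Section Glueing.
Context {R : realType}.
Local Notation pt := (R * R)%type.
Implicit Types (a b x y n : pt) (A B Omega : set pt).

Lemma has_grad_open A (f : pt -> R) x g : open A -> A x ->
  has_grad_on A f x g -> has_grad_on setT f x g.
Proof.
move=> oA Ax /has_gradP H; apply/has_gradP => e e0.
have nA : \forall y \near x, A y by apply: open_nbhs_nbhs.
near=> y => _; have Ay : A y by near: y.
by move: Ay; near: y; exact: H.
Unshelve. all: by end_near.
Qed.

(** Counterpart of [has_grad_glue] for the continuity of the gradient. *)
Lemma continuous_glue (I : finType) (A : I -> set pt) B (h : pt -> pt)
    (g : I -> pt -> pt) x :
  open B -> B x -> B `<=` \bigcup_i A i -> (forall i, closed (A i)) ->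
  (forall i, continuous (g i)) ->
  (forall i y, B y -> A i y -> h y = g i y) -> {for x, continuous h}.
Proof.
move=> oB Bx cov clA cg hg; apply/cvgrPdist_le => e e0.
have near_piece i : \forall y \near x, A i y -> `|h x - g i y| <= e.
  have [Ax|nAx] := pselect (A i x).
    rewrite (hg i x) //; have /cvgrPdist_le /(_ e e0) H := cg i x.
    by near=> y => _; near: y.
  have nA : nbhs x (~` A i).
    by apply: open_nbhs_nbhs; split => //; exact: closed_openC.
  near=> y => Ay; suff : (~` A i) y by [].
  by near: y.
have near_pieces : \forall y \near x, forall i, A i y -> `|h x - g i y| <= e.
  exact: (@filter_forall _ I _ (nbhs x)).
have nB : \forall y \near x, B y by apply: open_nbhs_nbhs.
near=> y; have By : B y by near: y.
have [i _ Ay] := cov _ By; rewrite (hg i y) //.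
have H : forall i, A i y -> `|h x - g i y| <= e by near: y.
exact: H.
Unshelve. all: by end_near.
Qed.

End Glueing.

Section Mesh.
Context {R : realType}.
Local Notation pt := (R * R)%type.
Implicit Types (a b x y n : pt).
Variables (Omega : set pt) (N : nat) (Th : 'I_N -> 'I_3 -> pt).
Variable ne : set pt -> pt.
Hypothesis hO : polygonal_domain Omega.
Hypothesis hTh : conforming_triangulation Omega Th.
Hypothesis hne : edge_normals Th ne.
Implicit Types (i j : 'I_N) (k l : 'I_3) (F G : 'I_N -> pt -> R).

Lemma mesh_det i : det_tri (Th i) != 0.
Proof. by have [] := hTh. Qed.
Local Hint Resolve mesh_det : core.

Lemma mesh_cover x : Omega x -> exists i, hull (Th i) x.
Proof.
have [_ cov _] := hTh; move=> /(@subset_closure _ Omega); rewrite cov => -[i _ hx].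
by exists i.
Qed.

(** Two triangles may run through their common edge in opposite directions. *)
Lemma shared_edge i j k l : edge (Th i) k = edge (Th j) l ->
  (Th j (l + 1) = Th i (k + 1) /\ Th j (l - 1) = Th i (k - 1)) \/
  (Th j (l + 1) = Th i (k - 1) /\ Th j (l - 1) = Th i (k + 1)).
Proof. by apply: segm_endpoints; exact: vertices_neq. Qed.

Lemma shared_edge_subtri i j k l : edge (Th i) k = edge (Th j) l ->
  forall t : R, 0 <= t <= 1 ->
    subtri (Th j) l (seg_path (Th i (k + 1)) (Th i (k - 1)) t).
Proof.
move=> E t t01; case: (shared_edge E) => -[<- <-]; first exact: edge_subtri.
rewrite seg_path_rev; apply: edge_subtri => //.
by case/andP: t01 => t0 t1; rewrite subr_ge0 t1 lerBlDr lerDl.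
Qed.

(** What the edge degrees of freedom provide in [U_3], and the affine normal
    derivatives in [U_2].  The normal of one triangle serves for both, since it
    depends on the edge as a set only. *)
Definition normal_single_valued F := forall i j k l,
  edge (Th i) k = edge (Th j) l -> forall t : R, 0 <= t <= 1 ->
  let x := seg_path (Th i (k + 1)) (Th i (k - 1)) t in
  dnormal (Th i) (nrm_of Th ne i k) (F i) x =
  dnormal (Th j) (nrm_of Th ne i k) (F j) x.

Lemma shared_vertex F i j k l : vertex_single_valued Th F ->
  edge (Th i) k = edge (Th j) l ->
  forall m, m = k + 1 \/ m = k - 1 ->
  F i (Th i m) = F j (Th i m) /\
  grad_on (hull (Th i)) (F i) (Th i m) = grad_on (hull (Th j)) (F j) (Th i m).
Proof.
move=> vF /shared_edge E m mk.
have [m' mm'] : exists m', Th i m = Th j m'.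
  by case: E mk => -[e1 e2] [->|->];
    [exists (l + 1)|exists (l - 1)|exists (l - 1)|exists (l + 1)].
by have := vF _ _ _ _ mm'; rewrite -mm'.
Qed.

(** By conformity two distinct triangles meet in a vertex, where the degrees of
    freedom agree, or along an edge, where [U3_edge_match] applies. *)
Lemma C1_compatible F i j x :
  (forall i, U3 (Th i) (nrm_of Th ne i) (F i)) ->
  vertex_single_valued Th F -> normal_single_valued F ->
  hull (Th i) x -> hull (Th j) x ->
  F i x = F j x /\ grad_on (hull (Th i)) (F i) x = grad_on (hull (Th j)) (F j) x.
Proof.
move=> FU vF nF ix jx; have [->//|ij] := eqVneq i j.
have [_ _ /(_ i j ij)] := hTh; set I := _ `&` _.
have Ix : I x by [].
case=> [I0|[k [l [vE IE]]]|[k [l [eE IE]]]].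
- by move: Ix; rewrite I0.
- by move: Ix; rewrite IE => ->; have := vF _ _ _ _ vE; rewrite -vE.
move: Ix; rewrite IE => -[t]; rewrite /= in_itv /= => t01 <-.
have [fa ga] := shared_vertex vF eE (or_introl erefl).
have [fb gb] := shared_vertex vF eE (or_intror erefl).
apply: (U3_edge_match (mesh_det i) (mesh_det j) (FU i) (FU j)
  (vertices_neq (mesh_det i) k) (hne i k) _ _ fa fb ga gb) => //.
- by move=> s; exact: edge_subtri.
- exact: (shared_edge_subtri eE).
- by move=> s s01; exact: (nF _ _ _ _ eE).
Qed.

(** The representative is the common value of the [F i] on the closed triangles.
    Values and gradients are first glued over the triangles; the continuity of the
    gradient is then read on the subtriangles, where it is the restriction of a
    polynomial gradient defined on the whole plane. *)
Lemma C1_representative F v :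
  (forall i, U3 (Th i) (nrm_of Th ne i) (F i)) ->
  vertex_single_valued Th F -> normal_single_valued F ->
  (forall i, v = F i %[ae leb2 in Omega `&` hull (Th i)]) ->
  exists2 u, C1 Omega u & v = u %[ae leb2 in Omega].
Proof.
move=> FU vF nF vae; have [oO _ _ _ _] := hO.
pose u x := if [pick i | `[< hull (Th i) x >]] is Some i then F i x else 0.
have uF i x : hull (Th i) x -> u x = F i x.
  move=> ix; rewrite /u; case: pickP => [j /asboolP jx|/(_ i)/asboolP//].
  by have [] := C1_compatible FU vF nF jx ix.
have uG i x : Omega x -> hull (Th i) x ->
    has_grad_on setT u x (grad_on (hull (Th i)) (F i) x).
  move=> Ox ix; apply: (has_grad_open oO Ox).
  apply: (@has_grad_glue _ _ (fun j => hull (Th j))).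
  - by move=> y /mesh_cover[j jy]; exists j.
  - by move=> j; exact: closed_hull.
  move=> j jx; have [_ ->] := C1_compatible FU vF nF ix jx.
  apply: eq_has_grad jx _ (U3_has_grad (mesh_det j) (FU j) jx) => y.
  by rewrite inE => /uF.
have spl i : exists Pg : ('I_3 -> pt -> R) * ('I_3 -> pt -> pt),
    (forall k, poly_with_grad 3 (Pg.1 k) (Pg.2 k)) /\
    (forall k x, subtri (Th i) k x -> has_grad_on (hull (Th i)) (F i) x (Pg.2 k x)).
  by have [P [g [? ? ?]]] := U3_spline (mesh_det i) (FU i); exists (P, g).
have [Pg PgP] := choice spl.
exists u.
  move=> x Ox; split.
    by have [i ix] := mesh_cover Ox; have [] := has_grad_differentiable (uG _ _ Ox ix).
  apply: (@continuous_glue _ ('I_N * 'I_3)%type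
    (fun ik => subtri (Th ik.1) ik.2) Omega _ (fun ik => (Pg ik.1).2 ik.2)) => //.
  - move=> y /mesh_cover[i /(hull_subtri (mesh_det i))[k ky]].
    by exists (i, k).
  - by move=> [i k]; exact: closed_subtri.
  - by move=> [i k]; have [/(_ k)[]] := PgP i.
  - move=> [i k] y Oy /= ky; have iy := subtri_hull (mesh_det i) ky.
    have [_ ->] := has_grad_differentiable (uG _ _ Oy iy).
    by apply: grad_on_hull => //; have [_] := PgP i; exact.
have aeF : Filter (nbhs (almost_everywhere (@leb2 R))) by exact: ae_filter_ringOfSetsType.
have vall : \forall x \ae leb2, forall i, (Omega `&` hull (Th i)) x -> v x = F i x.
  exact: (@filter_forall _ _ (fun i x => (Omega `&` hull (Th i)) x -> v x = F i x)
    _ aeF vae).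
near=> x => Ox; have vx : forall i, (Omega `&` hull (Th i)) x -> v x = F i x by near: x.
have [i ix] := mesh_cover Ox.
by rewrite (uF _ _ ix) (vx i).
Unshelve. all: by end_near.
Qed.

End Mesh.

(** * Single-valued normal derivatives and linear structure *)

Section Spaces.
Context {R : realType}.
Local Notation pt := (R * R)%type.
Implicit Types (a b x y n : pt) (h : pt -> R).

Lemma linear_on_segm a b h : poly_on_segm 1 a b h -> forall t : R, 0 <= t <= 1 ->
  h (seg_path a b t) = (1 - t) * h a + t * h b.
Proof.
move=> [q sq hq] t t01.
have z01 : (0 : R) \in `[0, 1] by rewrite in_itv /= lexx ler01.
have o01 : (1 : R) \in `[0, 1] by rewrite in_itv /= lexx ler01.
have tin : t \in `[0, 1] by rewrite in_itv.
rewrite -[in h a](seg_path0 a b) -[in h b](seg_path1 a b) !hq //.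
by rewrite !(horner_coef_wide _ sq) !big_ord_recl !big_ord0 /= /bump /=; ring.
Qed.

Lemma segm_integral_rev a b h : poly_on_segm 2 a b h -> poly_on_segm 2 b a h ->
  segm_integral a b h = segm_integral b a h.
Proof.
move=> hab hba; rewrite !segm_integral_simpson // (seg_path_rev b a).
have -> : 1 - 1 / 2 = 1 / 2 :> R by field.
by congr (Num.sqrt _ * _); rewrite /dot /=; ring.
Qed.

(** By Simpson's rule, ends and integral give the midpoint value, and three
    values determine a quadratic. *)
Lemma quadratic_on_segm_unique a b h h' : a != b ->
  poly_on_segm 2 a b h -> poly_on_segm 2 a b h' -> h a = h' a -> h b = h' b ->
  segm_integral a b h = segm_integral a b h' ->
  forall t : R, 0 <= t <= 1 -> h (seg_path a b t) = h' (seg_path a b t).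
Proof.
move=> ab hab hab' ha hb int t t01.
have hm : h (seg_path a b (1 / 2)) = h' (seg_path a b (1 / 2)).
  have sn0 : Num.sqrt (dot (b - a) (b - a)) != 0.
    by rewrite gt_eqF // sqrtr_gt0 dot_gt0 // subr_eq0 eq_sym.
  move: int; rewrite !segm_integral_simpson // ha hb => /(mulfI sn0).
  move: (h _) (h' _) (h' a) (h' b); clear => x y u v; lra.
have [r sr hr] := hab; have [r' sr' hr'] := hab'.
have i01 (s : R) : 0 <= s <= 1 -> s \in `[0, 1] by rewrite in_itv.
rewrite hr ?hr' ?i01 //; congr (_.[_]); apply: quadratic_unique => //.
- by rewrite -hr ?i01 -?hr' ?i01 ?seg_path0 ?lexx ?ler01.
- by rewrite -hr ?i01 -?hr' ?i01 ?seg_path1 ?lexx ?ler01.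
- have /i01 ? : 0 <= (1 / 2 : R) <= 1 by lra.
  by rewrite -hr // -hr'.
Qed.

Lemma poly_on_segmM m m' a b h h' : poly_on_segm m a b h ->
  poly_on_segm m' a b h' -> poly_on_segm (m + m') a b (fun x => h x * h' x).
Proof.
move=> [q sq hq] [q' sq' hq']; exists (q * q') => [|t t01].
  by rewrite (leq_trans (size_polyMleq _ _)) //; lia.
by rewrite hornerM hq ?hq'.
Qed.

Lemma poly_on_segm_linear m (c : R) a b h h' f : poly_on_segm m a b h ->
  poly_on_segm m a b h' ->
  (forall t : R, 0 <= t <= 1 ->
     f (seg_path a b t) = c * h (seg_path a b t) + h' (seg_path a b t)) ->
  poly_on_segm m a b f.
Proof.
move=> [q sq hq] [q' sq' hq'] fE; exists (c *: q + q') => [|t t01].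
  rewrite (leq_trans (size_polyD _ _)) // geq_max sq' andbT.
  exact: leq_trans (size_scale_leq _ _) sq.
by rewrite fE ?hq ?hq' ?hornerD ?hornerZ //; move: t01; rewrite in_itv.
Qed.

Lemma poly_on_segm_cst m a b (c : R) : poly_on_segm m a b (fun=> c).
Proof.
exists c%:P => [|t _]; last by rewrite hornerC.
by rewrite (leq_trans (size_polyC_leq1 _)).
Qed.

Lemma L2_0 (Omega : set pt) : L2 Omega (fun=> 0).
Proof.
rewrite /L2 /=.
have -> : patch (fun=> 0) Omega (fun=> 0) = (0 : pt -> R).
  by apply/funext => x; rewrite patchE if_same.
have p1 : (1 <= 2%:E :> \bar R)%E by rewrite lee_fin ler1n.
by have [] := Lfun_submod_closed (@leb2 R) p1.
Qed.

Lemma L2_linear (Omega : set pt) (c : R) (u v : pt -> R) :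
  L2 Omega u -> L2 Omega v -> L2 Omega (fun x => c * u x + v x).
Proof.
rewrite /L2 /= => Lu Lv.
have -> : patch (fun=> 0) Omega (fun x => c * u x + v x) =
   c *: patch (fun=> 0) Omega u + patch (fun=> 0) Omega v.
  apply/funext => x; rewrite !fctE /= !patchE; case: ifP => // _.
  by rewrite /GRing.scale /= mulr0 addr0.
have p1 : (1 <= 2%:E :> \bar R)%E by rewrite lee_fin ler1n.
by have [_ /(_ c)] := Lfun_submod_closed (@leb2 R) p1; exact.
Qed.

Variables (Omega : set pt) (N : nat) (Th : 'I_N -> 'I_3 -> pt).
Variable ne : set pt -> pt.
Hypothesis hTh : conforming_triangulation Omega Th.
Implicit Types (i j : 'I_N) (k l : 'I_3) (F G : 'I_N -> pt -> R).
Let dTh := mesh_det hTh.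

Lemma dnormal_linear i n (c : R) f h x :
  U3 (Th i) (nrm_of Th ne i) f -> U3 (Th i) (nrm_of Th ne i) h ->
  hull (Th i) x ->
  dnormal (Th i) n (fun y => c * f y + h y) x =
  c * dnormal (Th i) n f x + dnormal (Th i) n h x.
Proof.
by move=> fU hU ix; rewrite /dnormal (U3_grad_linear c (dTh i) fU hU ix) dotDl dotZl.
Qed.

Lemma edge_hull i k (t : R) : 0 <= t <= 1 ->
  hull (Th i) (seg_path (Th i (k + 1)) (Th i (k - 1)) t).
Proof. by move=> t01; exact: subtri_hull (edge_subtri (dTh i) k t01). Qed.

Lemma vertex_single_valued0 : vertex_single_valued Th (fun _ _ => 0).
Proof.
move=> i j k l _; split=> //.
by rewrite !grad_on_cst0 //; exact: hull_node.
Qed.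

Lemma vertex_single_valued_linear (c : R) F G :
  (forall i, U3 (Th i) (nrm_of Th ne i) (F i)) ->
  (forall i, U3 (Th i) (nrm_of Th ne i) (G i)) ->
  vertex_single_valued Th F -> vertex_single_valued Th G ->
  vertex_single_valued Th (fun i x => c * F i x + G i x).
Proof.
move=> FU GU vF vG i j k l E.
have [f1 f2] := vF _ _ _ _ E; have [g1 g2] := vG _ _ _ _ E.
rewrite f1 g1; split=> //.
rewrite (U3_grad_linear c (dTh i) (FU i) (GU i) (hull_node _ _)).
by rewrite (U3_grad_linear c (dTh j) (FU j) (GU j) (hull_node _ _)) f2 g2.
Qed.

Lemma U3_edge_dnormal i k n f : U3 (Th i) (nrm_of Th ne i) f ->
  poly_on_segm 2 (Th i (k + 1)) (Th i (k - 1)) (dnormal (Th i) n f).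
Proof. by move=> fU; apply: (U3_dnormal n (dTh i) fU (edge_subtri (dTh i) k)). Qed.

Lemma edge_single_valued0 : edge_single_valued Th ne (fun _ _ => 0).
Proof.
move=> i j k l E q _.
have z i' k' : segm_integral (Th i' (k' + 1)) (Th i' (k' - 1)) (fun x =>
    dnormal (Th i') (nrm_of Th ne i' k') (fun=> 0) x * q x) = 0.
  have d0 (t : R) : 0 <= t <= 1 ->
      let x := seg_path (Th i' (k' + 1)) (Th i' (k' - 1)) t in
      dnormal (Th i') (nrm_of Th ne i' k') (fun=> 0) x * q x = 0.
    by move=> t01 /=; rewrite /dnormal grad_on_cst0 ?dot0l ?mul0r //; exact: edge_hull.
  rewrite (@segm_integral_linear _ 0 _ _ (fun=> 0) (fun=> 0)).
  - rewrite segm_integral_simpson; last exact: poly_on_segm_cst.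
    by rewrite !mulr0 !addr0 !mul0r !mulr0 addr0.
  - exact: poly_on_segm_cst.
  - exact: poly_on_segm_cst.
  - by move=> t /d0 /= ->; rewrite mul0r addr0.
by rewrite !z.
Qed.

Lemma edge_single_valued_linear (c : R) F G :
  (forall i, U3 (Th i) (nrm_of Th ne i) (F i)) ->
  (forall i, U3 (Th i) (nrm_of Th ne i) (G i)) ->
  edge_single_valued Th ne F -> edge_single_valued Th ne G ->
  edge_single_valued Th ne (fun i x => c * F i x + G i x).
Proof.
move=> FU GU eF eG i j k l E q q0.
have lin i' k' : poly_on_segm 0 (Th i' (k' + 1)) (Th i' (k' - 1)) q ->
  segm_integral (Th i' (k' + 1)) (Th i' (k' - 1)) (fun x =>
    dnormal (Th i') (nrm_of Th ne i' k') (fun y => c * F i' y + G i' y) x * q x) =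
  c * segm_integral (Th i' (k' + 1)) (Th i' (k' - 1)) (fun x =>
    dnormal (Th i') (nrm_of Th ne i' k') (F i') x * q x) +
  segm_integral (Th i' (k' + 1)) (Th i' (k' - 1)) (fun x =>
    dnormal (Th i') (nrm_of Th ne i' k') (G i') x * q x).
  move=> q0'; apply: segm_integral_linear.
  - by apply: (@poly_on_segmM 2 0) => //; exact: U3_edge_dnormal.
  - by apply: (@poly_on_segmM 2 0) => //; exact: U3_edge_dnormal.
  - move=> t t01; rewrite (dnormal_linear _ _ (FU i') (GU i')); last exact: edge_hull.
    by rewrite mulrDl mulrA.
rewrite lin // (eF _ _ _ _ E q q0) (eG _ _ _ _ E q q0) lin //.
have [r sr qr] := q0; exists (r`_0)%:P => [|t t01]; first exact: size_polyC_leq1.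
have q1 s : 0 <= s <= 1 -> q (seg_path (Th i (k + 1)) (Th i (k - 1)) s) = r`_0.
  by move=> s01; rewrite qr ?in_itv // (size1_polyC sr) hornerC coefC.
rewrite hornerC; move: t01; rewrite in_itv /= => t01.
case: (shared_edge hTh E) => -[-> ->]; first exact: q1.
by rewrite seg_path_rev; apply: q1; case/andP: t01 => ? ?; apply/andP; split; lra.
Qed.

(** Edge integrals of the two neighbours are taken along possibly opposite
    orientations, which [segm_integral_rev] reconciles. *)
Lemma normal_single_valued_U3 F :
  (forall i, U3 (Th i) (nrm_of Th ne i) (F i)) ->
  vertex_single_valued Th F -> edge_single_valued Th ne F ->
  normal_single_valued Th ne F.
Proof.
move=> FU vF eF i j k l E t t01 /=.
set a := Th i (k + 1); set b := Th i (k - 1).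
set n := nrm_of Th ne i k.
have nE : nrm_of Th ne j l = n by rewrite /n /nrm_of E.
set h := dnormal (Th i) n (F i); set h' := dnormal (Th j) n (F j).
have hab : poly_on_segm 2 a b h by exact: U3_edge_dnormal.
have hab' : poly_on_segm 2 a b h'.
  exact: (U3_dnormal n (dTh j) (FU j) (shared_edge_subtri hTh E)).
have ha : h a = h' a.
  by have [_ g] := shared_vertex hTh vF E (or_introl erefl); rewrite /h /h' /dnormal g.
have hb : h b = h' b.
  by have [_ g] := shared_vertex hTh vF E (or_intror erefl); rewrite /h /h' /dnormal g.
have int : segm_integral a b h = segm_integral a b h'.
  have := eF _ _ _ _ E (fun=> 1) (poly_on_segm_cst 0 _ _ 1).
  under eq_fun do rewrite mulr1.
  move=> ->; under eq_fun do rewrite mulr1.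
  rewrite nE -/h'; have hj : poly_on_segm 2 (Th j (l + 1)) (Th j (l - 1)) h'.
    exact: U3_edge_dnormal.
  case: (shared_edge hTh E) hj => -[-> ->] hba; first reflexivity.
  exact: segm_integral_rev hba hab'.
exact: (quadratic_on_segm_unique (vertices_neq (dTh i) k)).
Qed.

(** On the edge both normal derivatives are affine with the same end values. *)
Lemma normal_single_valued_U2 F :
  (forall i, U2 (Th i) (nrm_of Th ne i) (F i)) ->
  vertex_single_valued Th F -> normal_single_valued Th ne F.
Proof.
move=> FU vF i j k l E t t01 /=.
have nE : nrm_of Th ne j l = nrm_of Th ne i k by rewrite /nrm_of E.
have [_ /(_ k) hi] := FU i; have [_ /(_ l)] := FU j; rewrite nE => hj.
have ga := (shared_vertex hTh vF E (or_introl erefl)).2.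
have gb := (shared_vertex hTh vF E (or_intror erefl)).2.
rewrite (linear_on_segm hi t01) {1 2}/dnormal ga gb.
case: (shared_edge hTh E) hj => -[-> ->] hj; first by rewrite (linear_on_segm hj t01).
rewrite seg_path_rev (linear_on_segm hj) ?subKr 1?addrC //.
by case/andP: t01 => ? ?; apply/andP; split; lra.
Qed.

End Spaces.

Theorem lemma3p7 (R : realType) (Omega : set (R * R)) (N : nat)
    (Th : 'I_N -> 'I_3 -> R * R) (ne : set (R * R) -> R * R)
    (hOmega : polygonal_domain Omega)
    (hTh : conforming_triangulation Omega Th)
    (hne : edge_normals Th ne) :
  subspace_of_C1 Omega (U2h Omega Th ne) /\
  subspace_of_C1 Omega (U3h Omega Th ne).
Proof.
have aeF : Filter (nbhs (almost_everywhere (@leb2 R))).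
  exact: ae_filter_ringOfSetsType.
have ae_linear c u v (F G : 'I_N -> R * R -> R) i :
    u = F i %[ae leb2 in Omega `&` hull (Th i)] ->
    v = G i %[ae leb2 in Omega `&` hull (Th i)] ->
    (fun x => c * u x + v x) = (fun x => c * F i x + G i x)
      %[ae leb2 in Omega `&` hull (Th i)].
  by move=> uF vG; near=> x => Hx; congr (_ * _ + _); move: Hx; near: x.
have dTh := mesh_det hTh.
split; split.
- split; first exact: L2_0.
  exists (fun _ _ => 0); split.
  + move=> i; split; first exact: U3_0.
    move=> k; apply: (@poly_on_segm_linear _ _ 0 _ _ (fun=> 0) (fun=> 0)).
    * exact: poly_on_segm_cst.
    * exact: poly_on_segm_cst.
    * move=> t t01; rewrite mulr0 addr0 /dnormal grad_on_cst0 ?dot0l //.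
      exact: (edge_hull hTh).
  + by move=> i; near=> x.
  + exact: (vertex_single_valued0 hTh).
- move=> c u v [Lu [F [FU uF vF]]] [Lv [G [GU vG vvG]]].
  split; first exact: L2_linear.
  have FU3 i := (FU i).1; have GU3 i := (GU i).1.
  exists (fun i x => c * F i x + G i x); split.
  + move=> i; split; first exact: U3_linear.
    move=> k; apply: (poly_on_segm_linear (c := c) ((FU i).2 k) ((GU i).2 k)) => t t01.
    by apply: (dnormal_linear hTh) => //; exact: (edge_hull hTh).
  + by move=> i; exact: ae_linear.
  + exact: (vertex_single_valued_linear hTh).
- move=> v [_ [F [FU vF vvF]]].
  apply: (C1_representative hOmega hTh hne (fun i => (FU i).1) vvF _ vF).
  exact: (normal_single_valued_U2 hTh).
- split; first exact: L2_0.
  exists (fun _ _ => 0); split.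
  + by move=> i; exact: U3_0.
  + by move=> i; near=> x.
  + exact: (vertex_single_valued0 hTh).
  + exact: (edge_single_valued0 _ hTh).
- move=> c u v [Lu [F [FU uF vF eF]]] [Lv [G [GU vG vvG eG]]].
  split; first exact: L2_linear.
  exists (fun i x => c * F i x + G i x); split.
  + by move=> i; exact: U3_linear.
  + by move=> i; exact: ae_linear.
  + exact: (vertex_single_valued_linear hTh).
  + exact: (edge_single_valued_linear hTh).
- move=> v [_ [F [FU vF vvF eF]]].
  apply: (C1_representative hOmega hTh hne FU vvF _ vF).
  exact: (normal_single_valued_U3 hTh).
Unshelve. all: by end_near.
Qed.
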